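(* Let $\rho\le\theta<1$. There exist $\gamma_\theta>0$ and $C_\theta<\infty$ such that, for every $u_0$ in $\mathcal{V}\cap L_2(g_\theta)$, the solution $u=(u_t)_{t\ge0}$ in $\mathcal{V}$, starting at $u_0$, of $$\dot u_t(k)=\alpha\left(u_t(k-1)^L-u_t(k)^L\right)-\beta\left(u_t(k)-u_t(k+1)\right),\qquad k\ge1,\ t\ge0,$$ satisfies $$\|u_t-\tilde u\|_{L_2(g_\theta)}\le e^{-\gamma_\theta t}\,C_\theta\,\|u_0-\tilde u\|_{L_2(g_\theta)},\qquad t\ge0.$$
   Context: $\alpha,\beta>0$ with $\rho=\alpha/\beta<1$, and $L\ge1$ is an integer. $\mathcal{V}$ is the set of sequences $(v(k))_{k\in\mathbb{N}}$, $\mathbb{N}=\{0,1,\dots\}$, with $v(0)=1$, $v(k)\ge v(k+1)$, $\lim_k v(k)=0$. It is known that for each $u_0\in\mathcal{V}$ the equation has a unique solution with values in $\mathcal{V}$. $\tilde u(k)=\rho^{1+L+\cdots+L^{k-1}}=\rho^{(L^k-1)/(L-1)}$ (read as $\rho^k$ if $L=1$), which is the unique stable (stationary) point of the equation in $\mathcal{V}$. $g_\theta=(\theta^k)_{k\ge1}$ and $\|x\|_{L_2(g_\theta)}^2=\sum_{k\ge1}x(k)^2\theta^{-k}$; $L_2(g_\theta)$ is the Hilbert space of real sequences $x=(x(k))_{k\in\mathbb{N}}$ with $x(0)=0$ and finite norm. $\mathcal{V}\cap L_2(g_\theta)$ denotes the set of $v\in\mathcal{V}$ with $\sum_{k\ge1}v(k)^2\theta^{-k}<\infty$;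 differences of two elements of this set belong to $L_2(g_\theta)$. *)

(* Defs.v *)
From Stdlib Require Import Reals List.
From Coquelicot Require Import Coquelicot.
Open Scope R_scope.

Definition in_V (v : nat -> R) : Prop :=
  v 0%nat = 1 /\ (forall k, v (S k) <= v k) /\ is_lim_seq v 0.

(* Derivative of f at t relative to [0, +oo): the ordinary derivative for
   t > 0, the right derivative at t = 0. *)
Definition is_derive_nonneg (f : R -> R) (t l : R) : Prop :=
  filterdiff f (within (fun s => 0 <= s) (locally t)) (fun h => scal h l).

(* Only the values u t for t >= 0 matter; k >= 1 is written S k. *)
Definition is_solution_in_V (alpha beta : R) (L : nat) (u : R -> nat -> R)
    : Prop :=
  (forall t, 0 <= t -> in_V (u t)) /\
  (forall t k, 0 <= t ->
     is_derive_nonneg (fun s => u s (S k)) t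
       (alpha * (u t k ^ L - u t (S k) ^ L)
        - beta * (u t (S k) - u t (S (S k))))).

Definition u_tilde (rho : R) (L : nat) (k : nat) : R :=
  rho ^ list_sum (map (fun i => Nat.pow L i) (seq 0 k)).

Definition geom_weight (theta : R) (k : nat) : R := theta ^ k.

(* Terms of the sum over k >= 1, shifted to start at index 0. *)
Definition L2_term (w x : nat -> R) (n : nat) : R := x (S n) ^ 2 * / w (S n).

Definition L2_summable (w x : nat -> R) : Prop := ex_series (L2_term w x).

Definition in_L2 (w x : nat -> R) : Prop := x 0%nat = 0 /\ L2_summable w x.

(* Meaningful only when L2_summable w x: Series is a junk value otherwise. *)
Definition L2_norm (w x : nat -> R) : R := sqrt (Series (L2_term w x)).

(* Main.v *)
Require Import Defs.
From Stdlib Require Import Reals List Lra Lia.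
From Coquelicot Require Import Coquelicot.
Open Scope R_scope.

(** Let [rho = alpha / beta], [p = theta ^ (- 1 / 2) > 1], so that the squared
    norm has weights [p ^ (2 k)], and [rho * p < 1].

    Uniformity over all initial data comes from convexity.  If [v] is a
    stationary profile, [y = u - v] solves a linear birth and death type
    equation whose coefficients [a] are difference quotients of [x ^ L], and
    [a k <= (1 - v k ^ L) / (1 - v k)] whatever [u] is ([pow_slope_chord]).
    This yields explicit weights, comparable to [p ^ k], for which the l1 norm
    of the positive part of [y] decays exponentially
    ([equilibrium_weight_dissipation], [positive_part_decay]).

    The quadratic energy is not always dissipated edge by edge: where [u]
    drops from near 1 to near 0, the quadratic form of the linear equation can
    fail to be negative. But at sites where [u] and [u_tilde] are small the
    coefficients [a] are small when [L >= 2], and the form is strictly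
    negative; when [L = 1] it is strictly negative everywhere
    ([edge_estimate]). The remaining sites contribute a source to the energy
    inequality, bounded by the squares of two l1 functionals. The first is the
    excess of [u] above a slightly raised stationary profile, with weight
    [p ^ k]: if [u] is not small at a distant site [k], its square is at least
    of order [p ^ (2 k)], which bounds the source there, and at time 0 it is at
    most a constant times the l2 norm ([excess_decay]). The second is
    the l1 norm of [u - u_tilde], needed at finitely many sites only
    ([difference_l1_decay]). Both decay exponentially, hence so does the l2
    norm ([quadratic_energy_decay], [l2_decay]).

    All sums are truncated to finitely many sites.  Boundary terms vanish in the
    limit by an a priori bound that uses the monotonicity of [u] in [k]
    ([weighted_terms_locally_bounded]) and by working with a ratio slightly less
    than [p], which is then increased to [p]. *)

(** * Differential inequalities on the half-line *)

(** Differentiability is asked for positive times only, continuity also at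
    time 0: this is what the mean value theorem consumes, and it is stable
    under finite sums and smooth compositions.  Continuity is two-sided, so a
    function given on the half-line is first extended by a constant to
    negative times. *)
Definition evolves (f f' : R -> R) : Prop :=
  (forall t, 0 <= t -> continuity_pt f t) /\
  (forall t, 0 < t -> is_derive f t (f' t)).

Lemma evolves_ext (f g f' g' : R -> R) :
  (forall t, f t = g t) -> (forall t, 0 < t -> f' t = g' t) ->
  evolves f f' -> evolves g g'.
Proof.
  intros Hfg Hd [Hc Hf]; split.
  - intros t Ht. apply continuity_pt_ext with f; auto.
  - intros t Ht. rewrite <- Hd by assumption.
    apply is_derive_ext with f; auto.
Qed.

Lemma evolves_C1 (F F' : R -> R) :
  (forall x, is_derive F x (F' x)) -> evolves F F'.
Proof.
  intros HF; split; intros t _; [ | apply HF ].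
  apply continuity_pt_filterlim, (ex_derive_continuous F t).
  exists (F' t); apply HF.
Qed.

Lemma evolves_plus (f g f' g' : R -> R) :
  evolves f f' -> evolves g g' ->
  evolves (fun t => f t + g t) (fun t => f' t + g' t).
Proof.
  intros [Hf Hf'] [Hg Hg']; split; intros t Ht.
  - apply (continuity_pt_plus f g); auto.
  - apply (is_derive_plus f g); auto.
Qed.

Lemma evolves_mult (f g f' g' : R -> R) :
  evolves f f' -> evolves g g' ->
  evolves (fun t => f t * g t) (fun t => f' t * g t + f t * g' t).
Proof.
  intros [Hf Hf'] [Hg Hg']; split; intros t Ht.
  - apply (continuity_pt_mult f g); auto.
  - apply (is_derive_mult f g); auto. intros; apply Rmult_comm.
Qed.

Lemma evolves_const (c : R) : evolves (fun _ => c) (fun _ => 0).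
Proof. apply evolves_C1. intros x; apply (is_derive_const c). Qed.

Lemma evolves_scal (c : R) (f f' : R -> R) :
  evolves f f' -> evolves (fun t => c * f t) (fun t => c * f' t).
Proof.
  intros Hf.
  apply evolves_ext with (2 := fun t _ => eq_trans
    (f_equal (fun z => z + c * f' t) (Rmult_0_l (f t))) (Rplus_0_l _))
    (3 := evolves_mult _ _ _ _ (evolves_const c) Hf).
  reflexivity.
Qed.

Lemma evolves_comp (F F' f f' : R -> R) :
  (forall x, is_derive F x (F' x)) -> evolves f f' ->
  evolves (fun t => F (f t)) (fun t => F' (f t) * f' t).
Proof.
  intros HF [Hf Hf']; split; intros t Ht.
  - apply (continuity_pt_comp f F); auto.
    apply continuity_pt_filterlim, (ex_derive_continuous F).
    exists (F' (f t)); apply HF.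
  - rewrite Rmult_comm. apply (is_derive_comp F f); auto.
Qed.

Lemma evolves_sum (f f' : nat -> R -> R) (n : nat) :
  (forall k, evolves (f k) (f' k)) ->
  evolves (fun t => sum_f_R0 (fun k => f k t) n)
          (fun t => sum_f_R0 (fun k => f' k t) n).
Proof.
  intros H; induction n as [|n IH]; simpl; [ apply H | ].
  apply evolves_plus; auto.
Qed.

Lemma evolves_nonincreasing (f f' : R -> R) (T : R) :
  evolves f f' -> (forall t, 0 < t <= T -> f' t <= 0) ->
  forall t, 0 <= t <= T -> f t <= f 0.
Proof.
  intros [Hc Hd] Hneg t [[Ht | <-] HtT]; [ | apply Rle_refl ].
  (* [MVT_gen] may return an endpoint, where f' is unconstrained. *)
  destruct (MVT_gen f 0 t (fun s => if Rlt_dec 0 s then f' s else 0))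
    as [c [Hcb Hfc]]; rewrite ?Rmin_left, ?Rmax_right in * by lra.
  - intros s Hs. destruct (Rlt_dec 0 s); [ | lra ]. apply Hd; lra.
  - intros s Hs. apply Hc; lra.
  - destruct (Rlt_dec 0 c); [ | lra ].
    assert (f' c <= 0) by (apply Hneg; lra). nra.
Qed.

Lemma exp_le_exp (x y : R) : x <= y -> exp x <= exp y.
Proof.
  intros [H | <-]; [ left; apply exp_increasing, H | apply Rle_refl ].
Qed.

Lemma exp_neg_le_1 (c t : R) : 0 <= c -> 0 <= t -> exp (- c * t) <= 1.
Proof. intros Hc Ht. rewrite <- exp_0. apply exp_le_exp; nra. Qed.

Lemma evolves_exp (c : R) :
  evolves (fun t => exp (c * t)) (fun t => c * exp (c * t)).
Proof.
  apply evolves_C1. intros x. auto_derive; [ easy | ring ].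
Qed.

Lemma gronwall_nonpos (f f' : R -> R) (c T : R) :
  evolves f f' -> (forall t, 0 < t <= T -> f' t <= c * f t) ->
  f 0 <= 0 -> forall t, 0 <= t <= T -> f t <= 0.
Proof.
  intros Hf Hle H0 t Ht.
  assert (H := evolves_nonincreasing _ _ T
    (evolves_mult _ _ _ _ (evolves_exp (- c)) Hf)).
  cbv beta in H.
  assert (Hm : exp (- c * t) * f t <= exp (- c * 0) * f 0).
  { apply H; [ | exact Ht ]. intros s Hs.
    assert (Hp := exp_pos (- c * s)). specialize (Hle s Hs). nra. }
  rewrite Rmult_0_r, exp_0 in Hm.
  assert (Hp := exp_pos (- c * t)). nra.
Qed.

(** [K exp (- g t) + e / c] is a supersolution of the differential inequality
    as soon as [D <= K (c - g)], so it stays above [f] once it starts there. *)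
Lemma gronwall_decay (f f' : R -> R) (c g D K e T : R) :
  evolves f f' -> 0 < c -> 0 <= e -> D <= K * (c - g) -> f 0 <= K ->
  (forall t, 0 < t <= T -> f' t <= - c * f t + D * exp (- g * t) + e) ->
  forall t, 0 <= t <= T -> f t <= exp (- g * t) * K + e / c.
Proof.
  intros Hf Hc He HD H0 Hle t Ht.
  assert (Hz : evolves (fun s => f s + (- K * exp (- g * s) + - (e / c)))
             (fun s => f' s + (- K * (- g * exp (- g * s)) + 0))).
  { apply evolves_plus; [ exact Hf | ].
    apply evolves_plus; [ | apply evolves_const ].
    apply evolves_scal, evolves_exp. }
  assert (H := gronwall_nonpos _ _ (- c) T Hz).
  cbv beta in H.
  enough (f t + (- K * exp (- g * t) + - (e / c)) <= 0) by lra.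
  apply H; [ | | exact Ht ].
  - intros s Hs. specialize (Hle s Hs).
    assert (Hp := exp_pos (- g * s)).
    replace (- c * (f s + (- K * exp (- g * s) + - (e / c))))
      with (- c * f s + c * K * exp (- g * s) + e) by (field; lra).
    nra.
  - rewrite Rmult_0_r, exp_0.
    assert (0 <= e / c) by (apply Rdiv_le_0_compat; lra). lra.
Qed.

Lemma is_derive_nonneg_bound (f : R -> R) (t l : R) :
  0 <= t -> is_derive_nonneg f t l ->
  forall eps : posreal, locally t (fun s => 0 <= s ->
    Rabs (f s - f t - (s - t) * l) <= eps * Rabs (s - t)).
Proof.
  intros Ht [_ H] eps.
  assert (Hl : is_filter_lim (within (fun s => 0 <= s) (locally t)) t).
  { intros P HP. unfold within.
    apply filter_imp with (2 := HP). auto. }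
  specialize (H t Hl eps). unfold within in H.
  exact H.
Qed.

(** Freezing a function at its initial value for negative times turns the
    one-sided derivative at 0 into two-sided continuity at 0. *)
Lemma evolves_extension (f f' : R -> R) :
  (forall t, 0 <= t -> is_derive_nonneg f t (f' t)) ->
  evolves (fun t => f (Rmax 0 t)) (fun t => f' (Rmax 0 t)).
Proof.
  intros H.
  assert (Hd : forall t, 0 < t ->
            is_derive (fun t => f (Rmax 0 t)) t (f' (Rmax 0 t))).
  { intros t Ht. rewrite (Rmax_right 0 t) by lra.
    assert (Hpos : locally t (fun s => 0 < s)) by (apply open_gt; exact Ht).
    apply is_derive_ext_loc with f.
    - apply filter_imp with (2 := Hpos). intros s Hs.
      rewrite Rmax_right; [ reflexivity | lra ].
    - split; [ apply is_linear_scal_l | ].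
      intros x Hx.
      apply (@is_filter_lim_locally_unique R_AbsRing R_NormedModule) in Hx.
      subst x.
      intros eps.
      assert (Hb := is_derive_nonneg_bound f t (f' t) (Rlt_le _ _ Ht)
                      (H t (Rlt_le _ _ Ht)) eps).
      generalize (filter_and _ _ Hpos Hb). apply filter_imp.
      intros s [Hs1 Hs2]. apply Hs2; lra. }
  split; [ | exact Hd ].
  intros t [Ht | <-].
  - apply continuity_pt_filterlim,
      (ex_derive_continuous (fun t => f (Rmax 0 t))).
    eexists; apply Hd; exact Ht.
  - assert (Hb := is_derive_nonneg_bound f 0 (f' 0) (Rle_refl 0)
                    (H 0 (Rle_refl 0)) (mkposreal 1 Rlt_0_1)).
    apply continuity_pt_locally. intros eps.
    set (M := Rabs (f' 0) + 2).
    assert (HM : 0 < M) by (unfold M; assert (Hx := Rabs_pos (f' 0)); lra).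
    assert (Hd' : 0 < eps / M)
      by (apply Rdiv_lt_0_compat; [ apply cond_pos | exact HM ]).
    destruct Hb as [d0 Hb].
    assert (Hm : 0 < Rmin d0 (eps / M))
      by (apply Rmin_pos; [ apply cond_pos | exact Hd' ]).
    exists (mkposreal _ Hm). intros y Hy.
    assert (Hy' : Rabs (y - 0) < Rmin d0 (eps / M)) by exact Hy.
    assert (Hy1 := Rmin_l d0 (eps / M)). assert (Hy2 := Rmin_r d0 (eps / M)).
    rewrite (Rmax_left 0 0) by lra.
    set (s := Rmax 0 y).
    assert (Hs : 0 <= s) by apply Rmax_l.
    assert (Hsy : Rabs (s - 0) <= Rabs (y - 0)).
    { unfold s, Rmax; destruct (Rle_dec 0 y); [ apply Rle_refl | ].
      rewrite Rminus_0_r, Rabs_R0; apply Rabs_pos. }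
    assert (Hs0 : ball 0 d0 s).
    { change (Rabs (s - 0) < d0). lra. }
    specialize (Hb s Hs0 Hs). simpl in Hb.
    assert (Hyp : M * Rabs (y - 0) < eps).
    { apply Rlt_le_trans with (M * (eps / M)).
      - apply Rmult_lt_compat_l; lra.
      - right; field; lra. }
    replace (f s - f 0) with ((f s - f 0 - (s - 0) * f' 0) + (s - 0) * f' 0)
      by ring.
    eapply Rle_lt_trans; [ apply Rabs_triang | ]. rewrite Rabs_mult.
    assert (Ha := Rabs_pos (f' 0)). assert (Hb' := Rabs_pos (s - 0)).
    unfold M in Hyp. nra.
Qed.

(** * Difference quotients of the power function *)

Fixpoint pow_slope (n : nat) (x y : R) : R :=
  match n with
  | O => 0
  | S m => x ^ m + y * pow_slope m x y
  end.

Lemma pow_slope_spec (n : nat) (x y : R) :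
  x ^ n - y ^ n = pow_slope n x y * (x - y).
Proof. induction n as [|n IH]; simpl; [ ring | nra ]. Qed.

Lemma pow_unit_interval (x : R) (n : nat) : 0 <= x <= 1 -> 0 <= x ^ n <= 1.
Proof.
  intros Hx; split; [ apply pow_le; lra | ].
  rewrite <- (pow1 n). apply pow_incr; lra.
Qed.

Lemma pow_slope_bounds (n : nat) (x y : R) :
  0 <= x <= 1 -> 0 <= y <= 1 -> 0 <= pow_slope n x y <= INR n.
Proof.
  intros Hx Hy; induction n as [|n IH]; [ simpl; lra | ].
  rewrite S_INR; simpl pow_slope.
  assert (H := pow_unit_interval x n Hx). nra.
Qed.

(** The power function is convex, so among all [x] in the unit interval the
    slope from [y] is largest at [x = 1].  This bound does not involve [x],
    and so makes estimates on the linearised flow uniform over all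
    solutions. *)
Lemma pow_slope_chord (n : nat) (x y : R) :
  0 <= x <= 1 -> 0 <= y <= 1 -> pow_slope n x y * (1 - y) <= 1 - y ^ n.
Proof.
  intros Hx Hy; induction n as [|n IH]; simpl; [ lra | ].
  assert (H := pow_unit_interval x n Hx). nra.
Qed.

Lemma pow_slope_small (n : nat) (x y e : R) :
  (2 <= n)%nat -> 0 <= x <= e -> 0 <= y <= e -> e <= 1 ->
  pow_slope n x y <= INR n * e.
Proof.
  intros Hn Hx Hy He. destruct n as [|[|n]]; try lia.
  rewrite S_INR. change (pow_slope (S (S n)) x y)
    with (x * x ^ n + y * pow_slope (S n) x y).
  assert (H1 := pow_unit_interval x n ltac:(lra)).
  assert (H2 := pow_slope_bounds (S n) x y ltac:(lra) ltac:(lra)). nra.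
Qed.

(** * Stationary profiles *)

(** Every sequence with [v (S k) - rho * v k ^ L] constant is stationary for the
    equation.  The constant [d = 0] gives the stable point; a positive [d] gives
    a profile above it with a positive limit at infinity, hence above all but
    finitely many terms of any sequence tending to 0. *)
Fixpoint equilibrium (rho d : R) (L k : nat) : R :=
  match k with
  | O => 1
  | S j => rho * equilibrium rho d L j ^ L + d
  end.

(** Both sides satisfy the same recursion: peeling off the first term of
    [1 + L + ... + L ^ k] leaves [L] times the previous exponent. *)
Lemma u_tilde_equilibrium (rho : R) (L k : nat) :
  u_tilde rho L k = equilibrium rho 0 L k.
Proof.
  induction k as [|k IH]; [ reflexivity | ].
  simpl equilibrium. rewrite <- IH. unfold u_tilde.
  assert (H : list_sum (map (fun i => Nat.pow L i) (seq 0 (S k)))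
              = S (list_sum (map (fun i => Nat.pow L i) (seq 0 k)) * L)%nat).
  { change (seq 0 (S k)) with (0%nat :: seq 1 k).
    rewrite <- seq_shift. simpl. f_equal. rewrite map_map.
    generalize (seq 0 k). intros l; induction l as [|i l IHl]; simpl in *;
      [ reflexivity | rewrite IHl; ring ]. }
  rewrite H, <- tech_pow_Rmult, pow_mult. ring.
Qed.

Lemma equilibrium_bounds (rho d : R) (L k : nat) :
  0 <= rho -> 0 <= d -> rho + d <= 1 -> 0 <= equilibrium rho d L k <= 1.
Proof.
  intros Hr Hd H; induction k as [|k IH]; simpl; [ lra | ].
  assert (Hp := pow_unit_interval _ L IH). nra.
Qed.

Lemma equilibrium_S_bounds (rho d : R) (L k : nat) :
  0 <= rho -> 0 <= d -> rho + d <= 1 ->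
  d <= equilibrium rho d L (S k) <= rho + d.
Proof.
  intros Hr Hd H; simpl.
  assert (Hp := pow_unit_interval _ L (equilibrium_bounds rho d L k Hr Hd H)).
  nra.
Qed.

Lemma equilibrium_shift (rho d : R) (L k : nat) :
  0 <= rho -> 0 <= d -> rho + d <= 1 ->
  equilibrium rho 0 L k <= equilibrium rho d L k /\
  equilibrium rho 0 L (S k) + d <= equilibrium rho d L (S k).
Proof.
  intros Hr Hd H.
  assert (Hb := fun k => equilibrium_bounds rho 0 L k Hr (Rle_refl 0)
    ltac:(lra)).
  assert (Hle : equilibrium rho 0 L k <= equilibrium rho d L k).
  { induction k as [|k IH]; simpl; [ lra | ].
    assert (Hp := pow_incr _ _ L (conj (proj1 (Hb k)) IH)). nra. }
  split; [ exact Hle | simpl ].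
  assert (Hp := pow_incr _ _ L (conj (proj1 (Hb k)) Hle)). nra.
Qed.

Lemma equilibrium_le_geom (rho d : R) (L k : nat) :
  0 <= rho < 1 -> 0 <= d -> rho + d <= 1 -> (1 <= L)%nat ->
  equilibrium rho d L k <= rho ^ k + d / (1 - rho).
Proof.
  intros Hr Hd H HL; induction k as [|k IH].
  - simpl. assert (0 <= d / (1 - rho)) by (apply Rdiv_le_0_compat; lra). lra.
  - simpl.
    assert (Hb := equilibrium_bounds rho d L k ltac:(lra) Hd H).
    destruct L as [|L]; [ lia | ]. simpl pow.
    assert (Hp := pow_unit_interval _ L Hb).
    replace (rho * rho ^ k + d / (1 - rho))
      with (rho * (rho ^ k + d / (1 - rho)) + d) by (field; lra).
    set (v := equilibrium rho d (S L) k) in *.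
    assert (v * v ^ L <= v) by nra.
    apply Rplus_le_compat_r, Rmult_le_compat_l; lra.
Qed.

(** * Weights for which the linearised flow contracts *)

(** The factor [/ (1 - v j)] in the increments compensates exactly for the
    slope bound [(1 - v k ^ L) / (1 - v k)] of [pow_slope_chord] when [v] is
    stationary, leaving a geometric weight of ratio [p]. *)
Fixpoint l1_weight (p : R) (v : nat -> R) (k : nat) : R :=
  match k with
  | O => 0
  | S j => l1_weight p v j + p ^ (S j) / (1 - v (S j))
  end.

Lemma l1_weight_lower (p : R) (v : nat -> R) (k : nat) :
  0 < p -> (forall j, 0 <= v (S j) < 1) ->
  0 <= l1_weight p v k /\ p ^ (S k) <= l1_weight p v (S k).
Proof.
  intros Hp Hv.
  assert (Hinc : forall j, p ^ (S j) <= p ^ (S j) / (1 - v (S j))).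
  { intros j. assert (Hj := Hv j). assert (H := pow_lt p (S j) Hp).
    revert H; generalize (p ^ S j); intros P H.
    apply Rle_div_r; [ lra | nra ]. }
  assert (H0 : 0 <= l1_weight p v k).
  { induction k as [|k IH]; [ simpl; lra | ].
    assert (H1 := Hinc k). assert (H2 := pow_lt p (S k) Hp).
    change (l1_weight p v (S k))
      with (l1_weight p v k + p ^ (S k) / (1 - v (S k))). lra. }
  split; [ exact H0 | ].
  assert (H1 := Hinc k).
  change (l1_weight p v (S k))
    with (l1_weight p v k + p ^ (S k) / (1 - v (S k))). lra.
Qed.

Lemma l1_weight_upper (p m : R) (v : nat -> R) (k : nat) :
  1 < p -> m < 1 -> (forall j, v (S j) <= m) ->
  l1_weight p v k <= p / ((1 - m) * (p - 1)) * p ^ k.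
Proof.
  intros Hp Hm Hv; induction k as [|k IH].
  - simpl. apply Rmult_le_pos; [ apply Rdiv_le_0_compat; nra | lra ].
  - change (l1_weight p v (S k))
      with (l1_weight p v k + p ^ (S k) / (1 - v (S k))).
    assert (Hk := pow_lt p k ltac:(lra)).
    assert (H : p ^ (S k) / (1 - v (S k)) <= p ^ (S k) / (1 - m)).
    { apply Rmult_le_compat_l; [ left; apply pow_lt; lra | ].
      apply Rinv_le_contravar; [ lra | specialize (Hv k); lra ]. }
    eapply Rle_trans; [ apply Rplus_le_compat; [ exact IH | exact H ] | ].
    right. simpl. field. lra.
Qed.

(** With [delta_k] the k-th increment of the weight, the chord bound and the
    recursion for [v] give [rho * a * delta_(k+1) <= (rho + d) * p * delta_k].
    Since [(rho + d) * p < 1], the service term wins by a multiple of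
    [delta_k], which controls the whole weight because the increments grow
    geometrically. *)
Lemma equilibrium_weight_dissipation
    (beta rho d p a : R) (L k : nat) :
  0 < beta -> 0 < rho -> 0 <= d -> (rho + d) * p < 1 -> 1 < p ->
  let v := equilibrium rho d L in
  let om := l1_weight p v in
  0 <= a -> a * (1 - v (S k)) <= 1 - v (S k) ^ L ->
  beta * rho * a * (om (S (S k)) - om (S k)) - beta * (om (S k) - om k)
  <= - (beta * (1 - (rho + d) * p) * ((1 - (rho + d)) * (p - 1)) / p)
     * om (S k).
Proof.
  intros Hb Hr Hd Hrp Hp v om Ha Hchord.
  assert (Hrd : rho + d < 1) by nra.
  assert (Hv : forall j, d <= v (S j) <= rho + d)
    by (intros j; apply equilibrium_S_bounds; lra).
  assert (Hv1 := Hv k). assert (Hv2 := Hv (S k)).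
  assert (Hpk : 0 < p ^ (S k)) by (apply pow_lt; lra).
  replace (om (S (S k)) - om (S k)) with (p * p ^ (S k) / (1 - v (S (S k))))
    by (unfold om; simpl; field; simpl in Hv2; lra).
  set (delta := p ^ (S k) / (1 - v (S k))).
  replace (om (S k) - om k) with delta
    by (unfold om, delta; simpl; field; simpl in Hv1; lra).
  (* The recursion gives rho (1 - v_k^L) = rho + d - v_(k+1), which is at most
     (rho + d) (1 - v_(k+1)) because v_(k+1) <= 1. *)
  assert (Hstep : rho * a * (1 - v (S k)) <= (rho + d) * (1 - v (S (S k)))).
  { assert (E : v (S (S k)) = rho * v (S k) ^ L + d) by reflexivity. nra. }
  assert (Hin : rho * a * (p * p ^ (S k) / (1 - v (S (S k))))
                <= (rho + d) * p * delta).
  { unfold delta.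
    replace (rho * a * (p * p ^ S k / (1 - v (S (S k)))))
      with (rho * a * (1 - v (S k)) *
            (p * p ^ S k / ((1 - v (S k)) * (1 - v (S (S k))))))
      by (field; lra).
    replace ((rho + d) * p * (p ^ S k / (1 - v (S k))))
      with ((rho + d) * (1 - v (S (S k))) *
            (p * p ^ S k / ((1 - v (S k)) * (1 - v (S (S k))))))
      by (field; lra).
    apply Rmult_le_compat_r; [ | exact Hstep ].
    apply Rdiv_le_0_compat; nra. }
  assert (Hup : om (S k) <= p / ((1 - (rho + d)) * (p - 1)) * delta).
  { eapply Rle_trans.
    - apply (l1_weight_upper p (rho + d) v (S k) Hp Hrd).
      intros j; apply Hv.
    - apply Rmult_le_compat_l; [ apply Rdiv_le_0_compat; nra | ].
      unfold delta. revert Hpk; generalize (p ^ S k); intros P Hpk.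
      apply Rle_div_r; [ lra | nra ]. }
  assert (Hup' : ((1 - (rho + d)) * (p - 1)) / p * om (S k) <= delta).
  { apply Rle_trans with (((1 - (rho + d)) * (p - 1)) / p *
      (p / ((1 - (rho + d)) * (p - 1)) * delta)).
    - apply Rmult_le_compat_l; [ apply Rdiv_le_0_compat; nra | exact Hup ].
    - right; field; lra. }
  apply Rle_trans with (- (beta * (1 - (rho + d) * p)) * delta); [ nra | ].
  replace (- (beta * (1 - (rho + d) * p) * ((1 - (rho + d)) * (p - 1)) / p)
     * om (S k))
    with (- (beta * (1 - (rho + d) * p)) *
          (((1 - (rho + d)) * (p - 1)) / p * om (S k))) by (field; lra).
  assert (0 < beta * (1 - (rho + d) * p)) by nra. nra.
Qed.

(** * Decay of weighted positive parts *)

Lemma partial_sum_mono (f : nat -> R) (m n : nat) :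
  (forall k, 0 <= f k) -> (m <= n)%nat -> sum_f_R0 f m <= sum_f_R0 f n.
Proof.
  intros Hf H; induction H as [|n H IH]; [ lra | ].
  simpl. specialize (Hf (S n)). lra.
Qed.

Lemma partial_sum_term (f : nat -> R) (k n : nat) :
  (forall j, 0 <= f j) -> (k <= n)%nat -> f k <= sum_f_R0 f n.
Proof.
  intros Hf H. eapply Rle_trans; [ | apply (partial_sum_mono f k n Hf H) ].
  destruct k; simpl; [ lra | ].
  assert (Hs := cond_pos_sum f k Hf). lra.
Qed.

(** A smooth convex majorant of the positive part, within [e / 2] of it, which
    allows differentiating weighted sums of positive parts up to an error that
    vanishes with [e]. *)
Definition soft_pos (e y : R) : R := (sqrt (y ^ 2 + e ^ 2) + y) / 2.

Definition soft_sign (e y : R) : R := (1 + y / sqrt (y ^ 2 + e ^ 2)) / 2.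

Lemma soft_pos_derive (e y : R) :
  0 < e -> is_derive (soft_pos e) y (soft_sign e y).
Proof.
  intros He. unfold soft_pos, soft_sign.
  assert (H : 0 < y ^ 2 + e ^ 2) by nra.
  assert (Hs := sqrt_lt_R0 _ H).
  auto_derive; [ simpl in H; lra | ].
  replace (y * (y * 1) + e * (e * 1)) with (y ^ 2 + e ^ 2) by ring.
  field; lra.
Qed.

Lemma soft_pos_facts (e y : R) :
  0 < e ->
  Rmax 0 y <= soft_pos e y <= Rmax 0 y + e / 2 /\
  (forall z, soft_sign e y * z <= Rmax 0 z) /\
  Rmax 0 y - e / 2 <= soft_sign e y * y.
Proof.
  intros He. unfold soft_pos, soft_sign.
  assert (H : 0 < y ^ 2 + e ^ 2) by nra.
  assert (Hs := sqrt_lt_R0 _ H).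
  assert (Hss := pow2_sqrt _ (Rlt_le _ _ H)).
  set (s := sqrt (y ^ 2 + e ^ 2)) in *. clearbody s.
  set (q := y / s).
  assert (Hq : q * s = y) by (unfold q; field; lra). clearbody q.
  assert (Hy : - s < y < s) by nra.
  assert (Hq1 : -1 < q < 1) by nra.
  assert (Hm : Rmax 0 y = (Rabs y + y) / 2).
  { unfold Rmax, Rabs.
    destruct (Rle_dec 0 y), (Rcase_abs y); lra. }
  assert (Ha : Rabs y <= s <= Rabs y + e).
  { unfold Rabs; destruct (Rcase_abs y); nra. }
  rewrite Hm. split; [ lra | split ].
  - intros z. unfold Rmax; destruct (Rle_dec 0 z); nra.
  -
    (* s - q y equals e^2 / s, and s >= e. *)
    assert (s - e <= q * y).
    { assert ((s - q * y) * s = e ^ 2) by nra. nra. }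
    assert (Rabs y <= s) by lra. lra.
Qed.

(** The equation satisfied by the difference [y] of two solutions, the
    nonlinearity being absorbed in the coefficients [a] (slopes of the power
    function), which depend on the solutions but are nonnegative. *)
Definition linear_flow (alpha beta : R) (a y : R -> nat -> R) : Prop :=
  (forall t, y t 0%nat = 0) /\
  (forall k, evolves (fun t => y t (S k))
    (fun t => alpha * (a t k * y t k - a t (S k) * y t (S k))
              - beta * (y t (S k) - y t (S (S k))))).

Lemma flux_summation_by_parts
    (alpha beta : R) (om a P : nat -> R) (n : nat) :
  om 0%nat = 0 -> P 0%nat = 0 ->
  sum_f_R0 (fun k => om (S k) *
    (alpha * (a k * P k - a (S k) * P (S k))
     - beta * (P (S k) - P (S (S k))))) n
  = sum_f_R0 (fun k => P (S k) *
      (alpha * a (S k) * (om (S (S k)) - om (S k))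
       - beta * (om (S k) - om k))) n
    - alpha * a (S n) * om (S (S n)) * P (S n)
    + beta * om (S n) * P (S (S n)).
Proof.
  intros Hom HP; induction n as [|n IH].
  - simpl. rewrite Hom, HP. ring.
  - rewrite !tech5, IH. ring.
Qed.

(** As [a] is nonnegative, the flow is cooperative and the positive part of [y]
    is a subsolution of the same linear equation.  Summation by parts moves the
    differences onto the weight, and the assumed inequality on [om] yields
    exponential decay.  Sums are truncated at a site where the flow entering
    from the right is negligible on the time interval considered. *)
Lemma positive_part_decay
    (alpha beta gamma A B : R) (om : nat -> R) (a y : R -> nat -> R) :
  0 < alpha -> 0 < beta -> 0 < gamma ->
  om 0%nat = 0 -> (forall k, 0 <= om k) ->
  linear_flow alpha beta a y ->
  (forall t k, 0 <= a t k <= A) ->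
  (forall t k, alpha * a t (S k) * (om (S (S k)) - om (S k))
               - beta * (om (S k) - om k) <= - gamma * om (S k)) ->
  (forall T e, 0 < e -> exists n0, forall n t, (n0 <= n)%nat -> 0 <= t <= T ->
     om (S n) * Rmax 0 (y t (S (S n))) <= e) ->
  (forall n, sum_f_R0 (fun k => om (S k) * Rmax 0 (y 0 (S k))) n <= B) ->
  forall t n, 0 <= t ->
    sum_f_R0 (fun k => om (S k) * Rmax 0 (y t (S k))) n
    <= exp (- gamma * t) * B.
Proof.
  intros Hal Hbe Hga Hom0 Hom [Hy0 Hy] Ha Hdiss Hbd HB T m HT.
  assert (HA : 0 <= A) by (specialize (Ha 0 0%nat); lra).
  apply le_epsilon. intros eta Heta.
  assert (He1 : 0 < eta * gamma / (2 * beta))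
    by (apply Rdiv_lt_0_compat; nra).
  destruct (Hbd T _ He1) as [n0 Hn0].
  set (n := max m n0).
  set (W := sum_f_R0 (fun k => om (S k)) n).
  assert (HW : 0 <= W) by (apply cond_pos_sum; intros; apply Hom).
  set (c1 := alpha * A + beta + gamma).
  assert (Hc1 : 0 < c1) by (unfold c1; nra).
  set (eps := eta / (2 * (W * (1 + c1 / gamma) + 1))).
  assert (Hcg : 0 < c1 / gamma) by (apply Rdiv_lt_0_compat; lra).
  assert (HWc : 0 <= W * (1 + c1 / gamma))
    by (apply Rmult_le_pos; lra).
  assert (Heps : 0 < eps) by (apply Rdiv_lt_0_compat; lra).
  assert (Hsmall : eps * W + eps * W * c1 / gamma <= eta / 2).
  { replace (eps * W + eps * W * c1 / gamma)
      with (eps * (W * (1 + c1 / gamma))) by (field; lra).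
    apply Rle_trans with (eps * (W * (1 + c1 / gamma) + 1)); [ nra | ].
    right; unfold eps; field. split; nra. }
  assert (Hev : evolves
    (fun t => sum_f_R0 (fun k => om (S k) * soft_pos eps (y t (S k))) n)
    (fun t => sum_f_R0 (fun k => om (S k) * (soft_sign eps (y t (S k)) *
       (alpha * (a t k * y t k - a t (S k) * y t (S k))
        - beta * (y t (S k) - y t (S (S k)))))) n)).
  { apply (evolves_sum (fun k t => om (S k) * soft_pos eps (y t (S k)))
      (fun k t => om (S k) * (soft_sign eps (y t (S k)) *
       (alpha * (a t k * y t k - a t (S k) * y t (S k))
        - beta * (y t (S k) - y t (S (S k))))))).
    intros k. apply evolves_scal.
    apply (evolves_comp (soft_pos eps) (soft_sign eps)
      (fun t => y t (S k))); [ | apply Hy ].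
    intros x; apply soft_pos_derive, Heps. }
  assert (Hcmp : forall t,
    sum_f_R0 (fun k => om (S k) * Rmax 0 (y t (S k))) n <=
    sum_f_R0 (fun k => om (S k) * soft_pos eps (y t (S k))) n <=
    sum_f_R0 (fun k => om (S k) * Rmax 0 (y t (S k))) n + eps * W).
  { intros t; split.
    - apply sum_Rle; intros k _. apply Rmult_le_compat_l; [ apply Hom | ].
      apply (soft_pos_facts eps (y t (S k)) Heps).
    - unfold W. rewrite scal_sum, <- sum_plus.
      apply sum_Rle; intros k _.
      assert (H := proj1 (soft_pos_facts eps (y t (S k)) Heps)).
      specialize (Hom (S k)). nra. }
  set (e := eta * gamma / 2 + eps * W * c1).
  assert (Hdec := gronwall_decay _ _ gamma gamma 0 (B + eps * W) e T Hev).
  cbv beta in Hdec.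
  assert (HewW : 0 <= eps * W) by nra.
  assert (He : 0 <= e) by (unfold e; nra).
  assert (Hfin : sum_f_R0 (fun k => om (S k) * soft_pos eps (y T (S k))) n
    <= exp (- gamma * T) * (B + eps * W) + e / gamma).
  { apply Hdec; try lra.
    - specialize (Hcmp 0). specialize (HB n). lra.
    - intros t Ht.
      set (P := fun k => Rmax 0 (y t k)).
      assert (HP : forall k, 0 <= P k) by (intros; apply Rmax_l).
      apply Rle_trans with (sum_f_R0 (fun k => om (S k) *
        (alpha * (a t k * P k - a t (S k) * P (S k))
         - beta * (P (S k) - P (S (S k))))
        + om (S k) * (eps * (alpha * A + beta))) n).
      + apply sum_Rle; intros k _.
        destruct (soft_pos_facts eps (y t (S k)) Heps) as [_ [Hz Hyy]].
        assert (H1 := Hz (y t k)). assert (H2 := Hz (y t (S (S k)))).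
        fold (P k) in H1. fold (P (S (S k))) in H2. fold (P (S k)) in Hyy.
        rewrite <- Rmult_plus_distr_l.
        apply Rmult_le_compat_l; [ apply Hom | ].
        set (sg := soft_sign eps (y t (S k))) in *. clearbody sg.
        assert (Ha1 := Ha t k). assert (Ha2 := Ha t (S k)).
        assert (Hi1 : a t k * (sg * y t k) <= a t k * P k)
          by (apply Rmult_le_compat_l; lra).
        assert (Hi2 : a t (S k) * (P (S k) - eps / 2)
                      <= a t (S k) * (sg * y t (S k)))
          by (apply Rmult_le_compat_l; lra).
        assert (Hi3 : a t (S k) * (eps / 2) <= A * eps) by nra.
        replace (sg * (alpha * (a t k * y t k - a t (S k) * y t (S k))
                 - beta * (y t (S k) - y t (S (S k)))))
          with (alpha * (a t k * (sg * y t k) - a t (S k) * (sg * y t (S k)))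
                - beta * (sg * y t (S k) - sg * y t (S (S k)))) by ring.
        assert (Hj1 : alpha * (a t k * (sg * y t k)
                               - a t (S k) * (sg * y t (S k)))
          <= alpha * (a t k * P k - a t (S k) * P (S k) + A * eps))
          by (apply Rmult_le_compat_l; lra).
        assert (Hj2 : beta * (P (S k) - P (S (S k)) - eps)
          <= beta * (sg * y t (S k) - sg * y t (S (S k))))
          by (apply Rmult_le_compat_l; lra).
        lra.
      + rewrite sum_plus, <- scal_sum.
        rewrite (flux_summation_by_parts alpha beta om (a t) P n Hom0).
        2:{ unfold P. rewrite Hy0. apply Rmax_left; lra. }
        fold W.
        assert (Hs : sum_f_R0 (fun k => P (S k) *
          (alpha * a t (S k) * (om (S (S k)) - om (S k))
           - beta * (om (S k) - om k))) n
          <= - gamma * sum_f_R0 (fun k => om (S k) * P (S k)) n).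
        { rewrite scal_sum. apply sum_Rle; intros k _.
          assert (H1 := Hdiss t k). assert (H2 := HP (S k)). nra. }
        assert (Hb1 : 0 <= alpha * a t (S n) * om (S (S n)) * P (S n)).
        { assert (H1 := Ha t (S n)). assert (H2 := Hom (S (S n))).
          assert (H3 := HP (S n)).
          repeat apply Rmult_le_pos; lra. }
        assert (Hb2 : beta * om (S n) * P (S (S n)) <= eta * gamma / 2).
        { assert (H1 := Hn0 n t ltac:(unfold n; lia) ltac:(lra)).
          fold (P (S (S n))) in H1.
          apply Rle_trans with (beta * (eta * gamma / (2 * beta))).
          - rewrite Rmult_assoc. apply Rmult_le_compat_l; lra.
          - right; field; lra. }
        assert (Hc2 := proj2 (Hcmp t)). fold P in Hc2.
        change (fun k => om (S k) * Rmax 0 (y t (S k)))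
          with (fun k => om (S k) * P (S k)) in Hc2.
        set (S1 := sum_f_R0 (fun k => om (S k) * P (S k)) n) in *.
        set (S2 := sum_f_R0 (fun k => om (S k) * soft_pos eps (y t (S k))) n)
          in *.
        assert (Hg : gamma * S2 <= gamma * (S1 + eps * W))
          by (apply Rmult_le_compat_l; lra).
        unfold e, c1.
        nra. }
  apply Rle_trans with
    (sum_f_R0 (fun k => om (S k) * Rmax 0 (y T (S k))) n).
  { apply partial_sum_mono; [ | unfold n; lia ].
    intros k. apply Rmult_le_pos; [ apply Hom | apply Rmax_l ]. }
  eapply Rle_trans; [ apply (Hcmp T) | ].
  eapply Rle_trans; [ exact Hfin | ].
  assert (Hex := exp_neg_le_1 gamma T ltac:(lra) HT).
  assert (Hep := exp_pos (- gamma * T)).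
  replace (e / gamma) with (eta / 2 + eps * W * c1 / gamma)
    by (unfold e; field; lra).
  nra.
Qed.

(** * Decay of weighted quadratic energies *)

Lemma energy_summation_by_parts
    (alpha beta p : R) (a x : nat -> R) (n : nat) :
  p <> 0 -> x 0%nat = 0 ->
  let z := fun k => p ^ k * x k in
  sum_f_R0 (fun k => 2 * z (S k) * (p ^ (S k) *
    (alpha * (a k * x k - a (S k) * x (S k))
     - beta * (x (S k) - x (S (S k)))))) n
  = sum_f_R0 (fun k =>
      2 * alpha * a (S k) * (p * z (S k) * z (S (S k)) - z (S k) ^ 2)
      + 2 * beta / p * z (S k) * z (S (S k)) - 2 * beta * z (S k) ^ 2) n
    - 2 * alpha * a (S n) * p * z (S n) * z (S (S n)).
Proof.
  intros Hp Hx z; unfold z; induction n as [|n IH].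
  - simpl. rewrite Hx. field; exact Hp.
  - rewrite !tech5, IH. simpl. field; exact Hp.
Qed.

(** The quadratic energy of the linear flow is a sum over edges, with the
    diagonal term [- 2 * beta * z ^ 2] from service.  If each edge is bounded by
    [P z_k ^ 2 + Q z_(k+1) ^ 2] up to a source whose sum decays exponentially,
    with [P + Q < 2 * beta], then so does the energy.  Sums are truncated, the
    boundary edge being negligible by assumption. *)
Lemma quadratic_energy_decay
    (alpha beta p P Q c g A D K : R) (a x bad : R -> nat -> R) :
  0 < alpha -> 0 < beta -> 0 < p -> 0 < c -> 0 <= Q ->
  P + Q - 2 * beta <= - c ->
  linear_flow alpha beta a x ->
  (forall t k, 0 <= a t k <= A) ->
  let z := fun t k => p ^ k * x t k in
  (forall t k, 0 <= t ->
     2 * alpha * a t (S k) * (p * z t (S k) * z t (S (S k)) - z t (S k) ^ 2)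
     + 2 * beta / p * z t (S k) * z t (S (S k))
     <= P * z t (S k) ^ 2 + Q * z t (S (S k)) ^ 2 + bad t k) ->
  (forall t n, 0 <= t -> sum_f_R0 (bad t) n <= D * exp (- g * t)) ->
  (forall T e, 0 < e -> exists n0, forall n t, (n0 <= n)%nat -> 0 <= t <= T ->
     z t n ^ 2 <= e) ->
  D <= K * (c - g) ->
  (forall n, sum_f_R0 (fun k => z 0 (S k) ^ 2) n <= K) ->
  forall t n, 0 <= t ->
    sum_f_R0 (fun k => z t (S k) ^ 2) n <= exp (- g * t) * K.
Proof.
  intros Hal Hbe Hp Hc HQ HPQ [Hx0 Hx] Ha z Hedge Hbad Hbd HDK HK T m HT.
  assert (HA : 0 <= A) by (specialize (Ha 0 0%nat); lra).
  apply le_epsilon. intros eta Heta.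
  set (M := Q + 2 * alpha * A * p).
  assert (HM : 0 <= M)
    by (unfold M; assert (0 <= alpha * A * p) by
          (repeat apply Rmult_le_pos; lra); lra).
  set (e1 := eta * c / (M + 1)).
  assert (He1 : 0 < e1) by (apply Rdiv_lt_0_compat; nra).
  assert (Hsmall : M * e1 <= eta * c).
  { apply Rle_trans with ((M + 1) * e1); [ nra | ].
    right; unfold e1; field; lra. }
  destruct (Hbd T _ He1) as [n0 Hn0].
  set (n := max m n0).
  assert (Hev : evolves (fun t => sum_f_R0 (fun k => z t (S k) ^ 2) n)
    (fun t => sum_f_R0 (fun k => 2 * z t (S k) * (p ^ (S k) *
       (alpha * (a t k * x t k - a t (S k) * x t (S k))
        - beta * (x t (S k) - x t (S (S k)))))) n)).
  { apply (evolves_sum (fun k t => z t (S k) ^ 2)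
      (fun k t => 2 * z t (S k) * (p ^ (S k) *
       (alpha * (a t k * x t k - a t (S k) * x t (S k))
        - beta * (x t (S k) - x t (S (S k))))))).
    intros k.
    apply (evolves_comp (fun y => y ^ 2) (fun y => 2 * y)
      (fun t => z t (S k))).
    - intros y. auto_derive; [ easy | ring ].
    - unfold z. apply evolves_scal, Hx. }
  assert (Hdec := gronwall_decay _ _ c g D K (M * e1) T Hev Hc).
  cbv beta in Hdec.
  apply Rle_trans with (sum_f_R0 (fun k => z T (S k) ^ 2) n).
  { apply partial_sum_mono; [ intros; apply pow2_ge_0 | unfold n; lia ]. }
  apply Rle_trans with (exp (- g * T) * K + M * e1 / c).
  2:{ apply Rplus_le_compat_l. apply Rle_div_l; lra. }
  apply Hdec; [ nra | exact HDK | apply HK | | lra ].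
  intros t Ht.
  eapply Rle_trans; [ right; exact (energy_summation_by_parts alpha beta p
    (a t) (x t) n (Rgt_not_eq _ _ Hp) (Hx0 t)) | ].
  change (fun k : nat => p ^ k * x t k) with (z t). cbv zeta.
  assert (Hz1 := Hn0 (S n) t ltac:(unfold n; lia) ltac:(lra)).
  assert (Hz2 := Hn0 (S (S n)) t ltac:(unfold n; lia) ltac:(lra)).
  assert (Hsum : sum_f_R0 (fun k =>
      2 * alpha * a t (S k) * (p * z t (S k) * z t (S (S k)) - z t (S k) ^ 2)
      + 2 * beta / p * z t (S k) * z t (S (S k))
      - 2 * beta * z t (S k) ^ 2) n
    <= sum_f_R0 (fun k => (P - 2 * beta) * z t (S k) ^ 2
         + Q * z t (S (S k)) ^ 2 + bad t k) n).
  { apply sum_Rle; intros k _. specialize (Hedge t k ltac:(lra)). lra. }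
  rewrite !sum_plus in Hsum.
  assert (E1 : sum_f_R0 (fun k => (P - 2 * beta) * z t (S k) ^ 2) n
     = (P - 2 * beta) * sum_f_R0 (fun k => z t (S k) ^ 2) n).
  { rewrite scal_sum. apply sum_eq; intros; ring. }
  assert (E2 : sum_f_R0 (fun k => Q * z t (S (S k)) ^ 2) n
     <= Q * (sum_f_R0 (fun k => z t (S k) ^ 2) n + e1)).
  { apply Rle_trans with (Q * sum_f_R0 (fun k => z t (S (S k)) ^ 2) n).
    - right. rewrite scal_sum. apply sum_eq; intros; ring.
    - apply Rmult_le_compat_l; [ exact HQ | ].
      assert (Hs := decomp_sum (fun k => z t (S k) ^ 2) (S n) ltac:(lia)).
      simpl pred in Hs. rewrite tech5 in Hs. cbv beta in Hs.
      assert (Hp2 := pow2_ge_0 (z t 1%nat)). lra. }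
  assert (Hb := Hbad t n ltac:(lra)).
  change (fun l : nat => bad t l) with (bad t) in Hsum.
  set (V := sum_f_R0 (fun k => z t (S k) ^ 2) n) in *.
  assert (HV : 0 <= V) by (apply cond_pos_sum; intros; apply pow2_ge_0).
  assert (Hcross : - (2 * alpha * a t (S n) * p * z t (S n) * z t (S (S n)))
     <= 2 * alpha * A * p * e1).
  { assert (Hm : - (z t (S n) * z t (S (S n))) <= e1) by nra.
    assert (Haa := Ha t (S n)).
    assert (Hk : 0 <= alpha * a t (S n) * p <= alpha * A * p).
    { split; [ repeat apply Rmult_le_pos; lra | ].
      apply Rmult_le_compat_r; [ lra | ]. apply Rmult_le_compat_l; lra. }
    replace (2 * alpha * a t (S n) * p * z t (S n) * z t (S (S n)))
      with (2 * (alpha * a t (S n) * p) * (z t (S n) * z t (S (S n))))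
      by ring.
    replace (2 * alpha * A * p * e1) with (2 * (alpha * A * p) * e1) by ring.
    set (k1 := alpha * a t (S n) * p) in *.
    set (k2 := alpha * A * p) in *. nra. }
  unfold M. nra.
Qed.

(** * Solutions of the mean-field equation *)

Definition solution_path (alpha beta : R) (L : nat) (u : R -> nat -> R)
    : Prop :=
  (forall t, in_V (u t)) /\
  (forall k, evolves (fun t => u t (S k))
    (fun t => alpha * (u t k ^ L - u t (S k) ^ L)
              - beta * (u t (S k) - u t (S (S k))))).

Lemma solution_path_extension (alpha beta : R) (L : nat) (u : R -> nat -> R) :
  is_solution_in_V alpha beta L u ->
  solution_path alpha beta L (fun t => u (Rmax 0 t)).
Proof.
  intros [HV Hd]; split.
  - intros t; apply HV, Rmax_l.
  - intros k.
    apply (evolves_extension (fun t => u t (S k))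
      (fun t => alpha * (u t k ^ L - u t (S k) ^ L)
                - beta * (u t (S k) - u t (S (S k))))).
    intros t Ht; apply Hd, Ht.
Qed.

Lemma in_V_bounds (v : nat -> R) (k : nat) : in_V v -> 0 <= v k <= 1.
Proof.
  intros [H0 [Hdec Hlim]]; split.
  - assert (Hle : forall j, v (k + j)%nat <= v k).
    { induction j as [|j IH]; [ rewrite Nat.add_0_r; lra | ].
      rewrite Nat.add_succ_r. specialize (Hdec (k + j)%nat). lra. }
    apply (is_lim_seq_le (fun j => v (j + k)%nat) (fun _ => v k) 0 (v k)).
    + intros j; rewrite Nat.add_comm; apply Hle.
    + apply is_lim_seq_incr_n, Hlim.
    + apply is_lim_seq_const.
  - induction k as [|k IH]; [ lra | ]. specialize (Hdec k). lra.
Qed.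

(** The source terms of [v] cancel, [v] being stationary. *)
Lemma difference_flow
    (alpha beta d : R) (L : nat) (u : R -> nat -> R) :
  0 < beta -> solution_path alpha beta L u ->
  let v := equilibrium (alpha / beta) d L in
  linear_flow alpha beta (fun t k => pow_slope L (u t k) (v k))
    (fun t k => u t k - v k).
Proof.
  intros Hb [HV Hu] v; split.
  - intros t. destruct (HV t) as [-> _]. unfold v; simpl; ring.
  - intros k.
    apply evolves_ext with (3 := evolves_plus _ _ _ _ (Hu k)
      (evolves_const (- v (S k)))); [ reflexivity | ].
    intros t _. rewrite <- !pow_slope_spec.
    assert (E : beta * (v (S k) - v (S (S k)))
                = alpha * (v k ^ L - v (S k) ^ L))
      by (unfold v; simpl; field; lra).
    lra.
Qed.

Lemma linear_flow_opp (alpha beta : R) (a y : R -> nat -> R) :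
  linear_flow alpha beta a y ->
  linear_flow alpha beta a (fun t k => - y t k).
Proof.
  intros [H0 H]; split.
  - intros t; rewrite H0; ring.
  - intros k.
    apply evolves_ext with (3 := evolves_scal (-1) _ _ (H k));
      intros; ring.
Qed.

(** Since [u] is nonincreasing in [k], the service terms lower the energy of
    every truncated sum, and the arrival terms are controlled by the energy
    itself.  Gronwall's inequality thus gives bounds that do not depend on the
    truncation; they are what makes boundary terms vanish elsewhere. *)
Lemma weighted_terms_locally_bounded
    (alpha beta p N : R) (L : nat) (u : R -> nat -> R) :
  0 < alpha -> 0 < beta -> 0 < p -> (1 <= L)%nat ->
  solution_path alpha beta L u ->
  (forall n, sum_f_R0 (fun k => (p ^ S k * u 0 (S k)) ^ 2) n <= N) ->
  forall T, exists M, forall t k, 0 <= t <= T -> (p ^ k * u t k) ^ 2 <= M.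
Proof.
  intros Hal Hbe Hp HL [HV Hu] HN T.
  assert (Hu01 : forall t k, 0 <= u t k <= 1)
    by (intros; apply in_V_bounds, HV).
  set (D := 2 * alpha * p).
  assert (HD : 0 < D) by (unfold D; nra).
  assert (HN0 : 0 <= N)
    by (eapply Rle_trans; [ apply (pow2_ge_0 (p ^ 1 * u 0 1%nat)) |
          apply (HN 0%nat) ]).
  set (z := fun t k => p ^ k * u t k).
  assert (Hz : forall t k, 0 <= z t k)
    by (intros; apply Rmult_le_pos; [ left; apply pow_lt, Hp | apply Hu01 ]).
  assert (Hsum : forall n t, 0 <= t <= T ->
    sum_f_R0 (fun k => z t (S k) ^ 2) n + 1 - (N + 1) * exp (D * t) <= 0).
  { intros n.
    assert (Hev : evolves
      (fun t => sum_f_R0 (fun k => z t (S k) ^ 2) n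
                + (1 + - (N + 1) * exp (D * t)))
      (fun t => sum_f_R0 (fun k => 2 * z t (S k) * (p ^ S k *
         (alpha * (u t k ^ L - u t (S k) ^ L)
          - beta * (u t (S k) - u t (S (S k)))))) n
         + (0 + - (N + 1) * (D * exp (D * t))))).
    { apply evolves_plus.
      - apply (evolves_sum (fun k t => z t (S k) ^ 2)
          (fun k t => 2 * z t (S k) * (p ^ S k *
         (alpha * (u t k ^ L - u t (S k) ^ L)
          - beta * (u t (S k) - u t (S (S k))))))).
        intros k.
        apply (evolves_comp (fun y => y ^ 2) (fun y => 2 * y)
          (fun t => z t (S k))).
        + intros y. auto_derive; [ easy | ring ].
        + unfold z. apply evolves_scal, Hu.
      - apply evolves_plus; [ apply evolves_const | ].
        apply evolves_scal, evolves_exp. }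
    assert (Hg := gronwall_nonpos _ _ D T Hev). cbv beta in Hg.
    intros t Ht.
    enough (sum_f_R0 (fun k => z t (S k) ^ 2) n
            + (1 + - (N + 1) * exp (D * t)) <= 0) by lra.
    apply Hg; [ | | exact Ht ].
    - intros s Hs.
      set (V := sum_f_R0 (fun k => z s (S k) ^ 2) n).
      enough (sum_f_R0 (fun k => 2 * z s (S k) * (p ^ S k *
         (alpha * (u s k ^ L - u s (S k) ^ L)
          - beta * (u s (S k) - u s (S (S k)))))) n <= D * (V + 1)) by nra.
      apply Rle_trans with (sum_f_R0 (fun k =>
        alpha * p * z s (S k) ^ 2 + alpha * p * z s k ^ 2) n).
      + apply sum_Rle; intros k _.
        assert (Hmon : u s (S (S k)) <= u s (S k)) by apply (HV s).
        assert (HpL : u s k ^ L <= u s k).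
        { destruct L as [|L']; [ lia | ]. simpl.
          assert (H1 := pow_unit_interval _ L' (Hu01 s k)).
          assert (H2 := Hu01 s k). nra. }
        assert (HqL := pow_unit_interval _ L (Hu01 s (S k))).
        assert (Hin : alpha * (u s k ^ L - u s (S k) ^ L)
            - beta * (u s (S k) - u s (S (S k))) <= alpha * u s k) by nra.
        assert (Hpk : 0 < p ^ S k) by (apply pow_lt, Hp).
        apply Rle_trans with (2 * z s (S k) * (p ^ S k * (alpha * u s k))).
        * apply Rmult_le_compat_l; [ specialize (Hz s (S k)); lra | ].
          apply Rmult_le_compat_l; lra.
        * replace (2 * z s (S k) * (p ^ S k * (alpha * u s k)))
            with (alpha * p * (2 * z s (S k) * z s k))
            by (unfold z; simpl; ring).
          rewrite <- Rmult_plus_distr_l.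
          apply Rmult_le_compat_l; [ nra | ].
          assert (H := pow2_ge_0 (z s (S k) - z s k)). nra.
      + rewrite sum_plus.
        replace (sum_f_R0 (fun k => alpha * p * z s (S k) ^ 2) n)
          with (alpha * p * V)
          by (unfold V; rewrite scal_sum; apply sum_eq; intros; ring).
        assert (Hsh : sum_f_R0 (fun k => z s k ^ 2) n <= V + 1).
        { assert (Hs' := decomp_sum (fun k => z s k ^ 2) (S n) ltac:(lia)).
          simpl pred in Hs'. rewrite tech5 in Hs'. cbv beta in Hs'.
          fold V in Hs'.
          assert (Hp2 := pow2_ge_0 (z s (S n))).
          assert (E0 : z s 0%nat ^ 2 = 1)
            by (unfold z; destruct (HV s) as [-> _]; simpl; ring).
          lra. }
        replace (sum_f_R0 (fun k => alpha * p * z s k ^ 2) n)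
          with (alpha * p * sum_f_R0 (fun k => z s k ^ 2) n)
          by (rewrite scal_sum; apply sum_eq; intros; ring).
        assert (0 < alpha * p) by nra. unfold D. nra.
    - rewrite Rmult_0_r, exp_0. specialize (HN n). unfold z. lra. }
  exists ((N + 1) * exp (D * T)). intros t k Ht.
  assert (Hexp : exp (D * t) <= exp (D * T)) by (apply exp_le_exp; nra).
  assert (HeT : (N + 1) * exp (D * t) <= (N + 1) * exp (D * T)) by nra.
  fold (z t k). destruct k as [|k].
  - assert (H := Hsum 0%nat t Ht). simpl sum_f_R0 in H.
    assert (Hp2 := pow2_ge_0 (z t 1%nat)).
    assert (E0 : z t 0%nat ^ 2 = 1)
      by (unfold z; destruct (HV t) as [-> _]; simpl; ring).
    lra.
  - assert (H := Hsum k t Ht).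
    assert (Hterm := partial_sum_term (fun k => z t (S k) ^ 2) k k
      (fun j => pow2_ge_0 _) (le_n k)). cbv beta in Hterm. lra.
Qed.

(** * Geometric sums *)

Lemma geometric_eventually_small (q e : R) :
  0 <= q < 1 -> 0 < e -> exists n0, forall n, (n0 <= n)%nat -> q ^ n <= e.
Proof.
  intros Hq He.
  destruct (pow_lt_1_zero q ltac:(rewrite Rabs_pos_eq; lra) e He) as [n0 H].
  exists n0; intros n Hn. specialize (H n Hn).
  rewrite Rabs_pos_eq in H; [ lra | apply pow_le; lra ].
Qed.

Lemma geometric_sum_le (p : R) (n : nat) :
  1 < p -> sum_f_R0 (fun k => p ^ S k) n <= p / (p - 1) * p ^ S n.
Proof.
  intros Hp; induction n as [|n IH].
  - simpl. replace (p / (p - 1) * (p * 1)) with (p * (p / (p - 1)))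
      by (field; lra).
    assert (1 <= p / (p - 1)) by (apply Rle_div_r; lra). nra.
  - rewrite tech5.
    replace (p / (p - 1) * p ^ S (S n))
      with (p / (p - 1) * p ^ S n + p ^ S (S n)) by (simpl; field; lra).
    lra.
Qed.

Lemma geometric_sum_bounded (q : R) (n : nat) :
  0 <= q < 1 -> sum_f_R0 (fun k => q ^ S k) n <= q / (1 - q).
Proof.
  intros Hq.
  enough (H : sum_f_R0 (fun k => q ^ S k) n
          = q / (1 - q) - q / (1 - q) * q ^ S n).
  { rewrite H. assert (H1 := pow_le q (S n) (proj1 Hq)).
    assert (0 <= q / (1 - q)) by (apply Rdiv_le_0_compat; lra). nra. }
  induction n as [|n IH]; [ simpl; field; lra | ].
  rewrite tech5, IH. simpl. field; lra.
Qed.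

Lemma sum_sq_le_sq_sum (f : nat -> R) (n : nat) :
  (forall k, 0 <= f k) ->
  sum_f_R0 (fun k => f k ^ 2) n <= sum_f_R0 f n ^ 2.
Proof.
  intros Hf; induction n as [|n IH]; [ simpl; lra | ].
  rewrite !tech5. assert (H1 := cond_pos_sum f n Hf).
  specialize (Hf (S n)). nra.
Qed.

Lemma sq_le_abs (a N : R) : 0 <= N -> a ^ 2 <= N ^ 2 -> Rabs a <= N.
Proof.
  intros HN H. rewrite <- (Rabs_pos_eq N HN).
  apply Rsqr_le_abs_0. unfold Rsqr. lra.
Qed.

(** * Quadratic estimate on an edge *)

(** Slopes are small wherever [u] and the stable point are both small, which
    gives the first term on the right.  The other sites are those with [k]
    below some [k1], where the weight is bounded and the plain difference
    suffices, and those where [u] is not small although [k] is large.  At the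
    latter, [u] exceeds the raised equilibrium by a fixed amount, so that the
    weighted excess is at least a constant times [p ^ k]. *)
Lemma slope_estimate (rho : R) (L : nat) (p eta : R) :
  0 < rho < 1 -> 1 < p -> rho * p < 1 -> (2 <= L)%nat -> 0 < eta ->
  exists d kappa, 0 < d /\ (rho + d) * p < 1 /\ 0 <= kappa /\
  forall u : nat -> R, (forall k, 0 <= u k <= 1) ->
  forall (P : R) (k : nat), 0 < P <= p ->
  let ut := equilibrium rho 0 L in
  (pow_slope L (u k) (ut k) * (P ^ k * (u k - ut k))) ^ 2
  <= eta ^ 2 * (P ^ k * (u k - ut k)) ^ 2
     + kappa * ((p ^ k * Rmax 0 (u k - equilibrium rho d L k)) ^ 2
                + (u k - ut k) ^ 2).
Proof.
  intros Hr Hp Hrp HL Heta.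
  assert (HLpos : 2 <= INR L) by (apply (le_INR 2); lia).
  (* Below the level e the slope is at most L e <= eta; the raised profile
     tends to at most d / (1 - rho) <= e / 4. *)
  set (e := Rmin 1 (eta / INR L)).
  assert (He : 0 < e)
    by (apply Rmin_pos; [ lra | apply Rdiv_lt_0_compat; lra ]).
  assert (He1 : e <= 1) by apply Rmin_l.
  assert (HeL : INR L * e <= eta).
  { apply Rle_trans with (INR L * (eta / INR L)).
    - apply Rmult_le_compat_l; [ lra | apply Rmin_r ].
    - right; field; lra. }
  set (d := Rmin ((1 - rho) * (e / 4)) ((/ p - rho) / 2)).
  assert (Hip : rho < / p) by (apply Rmult_lt_reg_r with p;
    [ lra | rewrite Rinv_l; lra ]).
  assert (Hd : 0 < d) by (apply Rmin_pos; nra).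
  assert (Hd1 : d <= (1 - rho) * (e / 4)) by apply Rmin_l.
  assert (Hd2 : d <= (/ p - rho) / 2) by apply Rmin_r.
  assert (Hdp : (rho + d) * p < 1).
  { apply Rlt_le_trans with (/ p * p); [ | rewrite Rinv_l; lra ].
    apply Rmult_lt_compat_r; lra. }
  assert (Hd3 : d / (1 - rho) <= e / 4) by (apply Rle_div_l; lra).
  destruct (geometric_eventually_small rho (e / 4) ltac:(lra) ltac:(lra))
    as [k1 Hk1].
  assert (Hpk1 : 0 < p ^ k1) by (apply pow_lt; lra).
  set (kappa := INR L ^ 2 * ((p ^ k1) ^ 2 + 4 / e ^ 2)).
  assert (H4e : 0 < 4 / e ^ 2) by (apply Rdiv_lt_0_compat; nra).
  assert (Hkap : 0 <= kappa) by (unfold kappa; apply Rmult_le_pos; nra).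
  exists d, kappa.
  split; [ exact Hd | split; [ exact Hdp | split; [ exact Hkap | ] ] ].
  intros u Hu P k HP ut.
  assert (Hrd : rho + d <= 1) by nra.
  assert (Hut : 0 <= ut k <= 1) by (apply equilibrium_bounds; lra).
  assert (Ha := pow_slope_bounds L (u k) (ut k) (Hu k) Hut).
  set (a := pow_slope L (u k) (ut k)) in *.
  assert (HPk : 0 < P ^ k) by (apply pow_lt; lra).
  assert (HPp : P ^ k <= p ^ k) by (apply pow_incr; lra).
  set (s := p ^ k * Rmax 0 (u k - equilibrium rho d L k)).
  assert (Hx : -1 <= u k - ut k <= 1) by (specialize (Hu k); lra).
  set (x := u k - ut k) in *.
  assert (HaL : (a * (P ^ k * x)) ^ 2 <= INR L ^ 2 * (P ^ k * x) ^ 2).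
  { rewrite Rpow_mult_distr. apply Rmult_le_compat_r; [ apply pow2_ge_0 | ].
    apply pow_incr; lra. }
  assert (Hpos : 0 <= eta ^ 2 * (P ^ k * x) ^ 2)
    by (apply Rmult_le_pos; apply pow2_ge_0).
  assert (Hs2 := pow2_ge_0 s). assert (Hx2 := pow2_ge_0 x).
  destruct (Nat.lt_ge_cases k k1) as [Hk | Hk].
  - assert (Hpp : P ^ k <= p ^ k1).
    { eapply Rle_trans; [ exact HPp | ]. apply Rle_pow; [ lra | lia ]. }
    assert (H1 : (P ^ k * x) ^ 2 <= (p ^ k1) ^ 2 * x ^ 2).
    { rewrite Rpow_mult_distr. apply Rmult_le_compat_r; [ exact Hx2 | ].
      apply pow_incr; lra. }
    assert (H2 : INR L ^ 2 * (P ^ k * x) ^ 2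
                 <= INR L ^ 2 * ((p ^ k1) ^ 2 * x ^ 2))
      by (apply Rmult_le_compat_l; [ apply pow2_ge_0 | exact H1 ]).
    assert (H3 : kappa * x ^ 2 <= kappa * (s ^ 2 + x ^ 2))
      by (apply Rmult_le_compat_l; lra).
    assert (H4 : INR L ^ 2 * ((p ^ k1) ^ 2 * x ^ 2) <= kappa * x ^ 2).
    { unfold kappa. rewrite <- Rmult_assoc.
      apply Rmult_le_compat_r; [ exact Hx2 | ].
      apply Rmult_le_compat_l; [ apply pow2_ge_0 | lra ]. }
    lra.
  - assert (Hv : equilibrium rho d L k <= e / 2).
    { assert (H := equilibrium_le_geom rho d L k ltac:(lra) ltac:(lra) Hrd
        ltac:(lia)). specialize (Hk1 k Hk). lra. }
    assert (Hutv := proj1 (equilibrium_shift rho d L k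
      ltac:(lra) ltac:(lra) Hrd)).
    fold ut in Hutv.
    destruct (Rle_or_lt (u k) e) as [Hue | Hue].
    + assert (Hae : a <= eta).
      { apply Rle_trans with (INR L * e); [ | exact HeL ].
        apply pow_slope_small; try lra; try lia.
        specialize (Hu k); lra. }
      assert (H1 : (a * (P ^ k * x)) ^ 2 <= eta ^ 2 * (P ^ k * x) ^ 2).
      { rewrite Rpow_mult_distr. apply Rmult_le_compat_r; [ apply pow2_ge_0 | ].
        apply pow_incr; lra. }
      assert (0 <= kappa * (s ^ 2 + x ^ 2)) by (apply Rmult_le_pos; lra).
      lra.
    + assert (Hy : e / 2 <= Rmax 0 (u k - equilibrium rho d L k))
        by (eapply Rle_trans; [ | apply Rmax_r ]; lra).
      assert (H1 : (P ^ k * x) ^ 2 <= (p ^ k) ^ 2).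
      { rewrite Rpow_mult_distr.
        assert ((P ^ k) ^ 2 <= (p ^ k) ^ 2) by (apply pow_incr; lra).
        assert (x ^ 2 <= 1) by nra.
        assert (0 <= (P ^ k) ^ 2) by apply pow2_ge_0. nra. }
      assert (H2 : (p ^ k) ^ 2 <= 4 / e ^ 2 * s ^ 2).
      { unfold s. rewrite Rpow_mult_distr.
        set (m := Rmax 0 (u k - equilibrium rho d L k)) in *.
        replace (4 / e ^ 2 * ((p ^ k) ^ 2 * m ^ 2))
          with ((p ^ k) ^ 2 * (2 * m / e) ^ 2) by (field; lra).
        assert (1 <= 2 * m / e) by (apply Rle_div_r; lra).
        assert (1 <= (2 * m / e) ^ 2) by nra.
        assert (0 <= (p ^ k) ^ 2) by apply pow2_ge_0. nra. }
      assert (H3 : kappa * s ^ 2 <= kappa * (s ^ 2 + x ^ 2))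
        by (apply Rmult_le_compat_l; lra).
      assert (H4 : INR L ^ 2 * (4 / e ^ 2 * s ^ 2) <= kappa * s ^ 2).
      { unfold kappa. rewrite <- Rmult_assoc.
        apply Rmult_le_compat_r; [ exact Hs2 | ].
        apply Rmult_le_compat_l; [ apply pow2_ge_0 | ].
        assert (0 <= (p ^ k1) ^ 2) by apply pow2_ge_0. lra. }
      assert (H5 : INR L ^ 2 * (P ^ k * x) ^ 2
                   <= INR L ^ 2 * (4 / e ^ 2 * s ^ 2))
        by (apply Rmult_le_compat_l; [ apply pow2_ge_0 | lra ]).
      lra.
Qed.

(** For [L = 1] the slope is 1 and the quadratic form on an edge is negative by
    itself, with no source.  For [L >= 2] the arrival part is handled by
    [slope_estimate], leaving only the service part, whose form is negative
    since [P > 1].  The gap [c] is uniform for [P] in [q, p]. *)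
Lemma edge_estimate (alpha beta p q : R) (L : nat) :
  0 < alpha -> 0 < beta -> 1 < q < p -> alpha / beta * p < 1 -> (1 <= L)%nat ->
  exists c d kappa,
  0 < c /\ 0 < d /\ (alpha / beta + d) * p < 1 /\ 0 <= kappa /\
  forall P, q <= P <= p -> exists A B, 0 <= B /\ A + B - 2 * beta <= - c /\
  forall u : nat -> R, (forall k, 0 <= u k <= 1) ->
  forall (k : nat),
  let ut := equilibrium (alpha / beta) 0 L in
  let z := fun k => P ^ k * (u k - ut k) in
  2 * alpha * pow_slope L (u (S k)) (ut (S k))
    * (P * z (S k) * z (S (S k)) - z (S k) ^ 2)
  + 2 * beta / P * z (S k) * z (S (S k))
  <= A * z (S k) ^ 2 + B * z (S (S k)) ^ 2
     + kappa * ((p ^ S k *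
           Rmax 0 (u (S k) - equilibrium (alpha / beta) d L (S k))) ^ 2
                + (u (S k) - ut (S k)) ^ 2).
Proof.
  intros Hal Hbe Hq Hrp HL.
  assert (Hr : 0 < alpha / beta) by (apply Rdiv_lt_0_compat; lra).
  set (rho := alpha / beta) in *.
  assert (Hr1 : rho < 1) by nra.
  assert (Ear : alpha = beta * rho) by (unfold rho; field; lra).
  clearbody rho.
  assert (Hcross : forall P z z', 0 < P ->
    2 * beta / P * z * z' <= beta / P * z ^ 2 + beta / P * z' ^ 2).
  { intros P z z' HP.
    assert (Hbp : 0 < beta / P) by (apply Rdiv_lt_0_compat; lra).
    replace (2 * beta / P * z * z') with (beta / P * (2 * z * z'))
      by (field; lra).
    assert (H := pow2_ge_0 (z - z')). nra. }
  destruct (Nat.eq_dec L 1) as [-> | HL1].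
  - exists (2 * (q - 1) * (beta / p - alpha)), ((1 / p - rho) / 2), 0.
    assert (Hpp : 0 < 1 / p - rho).
    { enough (rho < 1 / p) by lra. apply (Rlt_div_r rho 1 p); lra. }
    assert (Hgap : 0 < beta / p - alpha).
    { rewrite Ear. replace (beta / p - beta * rho)
        with (beta * (1 / p - rho)) by (field; lra). nra. }
    split; [ apply Rmult_lt_0_compat; lra | ].
    split; [ lra | split; [ | split; [ lra | ] ] ].
    { apply Rlt_le_trans with (1 / p * p); [ | right; field; lra ].
      apply Rmult_lt_compat_r; lra. }
    intros P HP.
    assert (HbP : 0 < beta / P) by (apply Rdiv_lt_0_compat; lra).
    assert (HbPp : beta / p <= beta / P).
    { apply Rmult_le_compat_l; [ lra | ]. apply Rinv_le_contravar; lra. }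
    exists (alpha * P - 2 * alpha + beta / P), (alpha * P + beta / P).
    split; [ nra | split ].
    + assert (E : beta = beta / P * P) by (field; lra).
      assert (Hm : (q - 1) * (beta / p - alpha) <= (P - 1) * (beta / P - alpha))
        by (apply Rmult_le_compat; lra).
      lra.
    + intros u Hu k ut z.
      assert (H1 := Hcross P (z (S k)) (z (S (S k))) ltac:(lra)).
      replace (pow_slope 1 (u (S k)) (ut (S k))) with 1 by (simpl; ring).
      assert (H2 := pow2_ge_0 (z (S k) - z (S (S k)))).
      assert (H3 : 0 < alpha * P) by nra.
      set (zz := z (S k)) in *. set (zz' := z (S (S k))) in *.
      assert (H4 : alpha * P * (2 * zz * zz') <= alpha * P * (zz ^ 2 + zz' ^ 2))
        by (apply Rmult_le_compat_l; nra).
      lra.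
  - assert (HL2 : (2 <= L)%nat) by lia.
    set (c := beta * (1 - / q)).
    assert (Hiq : 0 < / q < 1).
    { split; [ apply Rinv_0_lt_compat; lra | ].
      rewrite <- Rinv_1. apply Rinv_lt_contravar; lra. }
    assert (Hc : 0 < c) by (unfold c; nra).
    set (s := c / 2).
    set (eta := s / (alpha * p)).
    assert (Hap : 0 < alpha * p) by nra.
    assert (Heta : 0 < eta) by (apply Rdiv_lt_0_compat; unfold s; lra).
    assert (Eeta : alpha * p * eta = s) by (unfold eta; field; lra).
    destruct (slope_estimate rho L p eta ltac:(lra) ltac:(lra) Hrp HL2 Heta)
      as [d [kappa [Hd [Hdp [Hkap Hsl]]]]].
    assert (Hs : 0 < s) by (unfold s; lra).
    set (w := (alpha * p) ^ 2 / s).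
    assert (Hw : 0 < w) by (apply Rdiv_lt_0_compat; [ nra | lra ]).
    exists c, d, (w * kappa).
    split; [ exact Hc | split; [ exact Hd | split; [ exact Hdp | split ] ] ].
    { apply Rmult_le_pos; lra. }
    intros P HP.
    assert (HbP : 0 < beta / P) by (apply Rdiv_lt_0_compat; lra).
    exists (beta / P + s), (beta / P + s).
    split; [ lra | split ].
    + assert (HPq : beta / P <= beta / q).
      { apply Rmult_le_compat_l; [ lra | ]. apply Rinv_le_contravar; lra. }
      unfold s, c. unfold Rdiv in *. lra.
    + intros u Hu k ut z.
      assert (H1 := Hcross P (z (S k)) (z (S (S k))) ltac:(lra)).
      assert (H2 := Hsl u Hu P (S k) ltac:(lra)). cbv zeta in H2.
      fold ut in H2.
      assert (Hut : 0 <= ut (S k) <= 1) by (apply equilibrium_bounds; lra).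
      assert (Ha := pow_slope_bounds L _ _ (Hu (S k)) Hut).
      change (P ^ S k * (u (S k) - ut (S k))) with (z (S k)) in H2.
      set (a := pow_slope L (u (S k)) (ut (S k))) in *.
      set (bad := (p ^ S k * Rmax 0 (u (S k) - equilibrium rho d L (S k))) ^ 2
                + (u (S k) - ut (S k)) ^ 2) in *.
      set (zz := z (S k)) in *. set (zz' := z (S (S k))) in *.
      assert (H3 : w * (a * zz) ^ 2 <= w * (eta ^ 2 * zz ^ 2 + kappa * bad))
        by (apply Rmult_le_compat_l; lra).
      assert (Ew : w * eta ^ 2 = s).
      { unfold w. rewrite <- Eeta. field. split; nra. }
      (* Young's inequality, with weight s on the right end of the edge. *)
      assert (H4 : 2 * alpha * P * (a * zz) * zz'
                   <= s * zz' ^ 2 + w * (a * zz) ^ 2).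
      { assert (H5 : 0 <= (s * zz' - alpha * P * (a * zz)) ^ 2 / s)
          by (apply Rdiv_le_0_compat; [ apply pow2_ge_0 | exact Hs ]).
        replace ((s * zz' - alpha * P * (a * zz)) ^ 2 / s)
          with (s * zz' ^ 2 - 2 * alpha * P * (a * zz) * zz'
                + (alpha * P) ^ 2 / s * (a * zz) ^ 2) in H5 by (field; lra).
        assert (H6 : (alpha * P) ^ 2 / s <= w).
        { unfold w. apply Rmult_le_compat_r;
            [ left; apply Rinv_0_lt_compat, Hs | ].
          apply pow_incr; nra. }
        assert (H7 := pow2_ge_0 (a * zz)). nra. }
      assert (H8 : 0 <= alpha * a * zz ^ 2)
        by (apply Rmult_le_pos; [ nra | apply pow2_ge_0 ]).
      rewrite Rmult_plus_distr_l in H3.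
      rewrite <- Rmult_assoc, Ew in H3. lra.
Qed.

(** * Decay of the two weighted l1 functionals *)

(** [positive_part_decay] for the weights attached to a stationary profile,
    which are comparable to [p ^ k]; stated for any [y] so as to apply to a
    difference and to its opposite. *)
Lemma equilibrium_l1_decay (alpha beta d p : R) (L : nat) :
  0 < alpha -> 0 < beta -> 0 <= d -> 1 < p -> (alpha / beta + d) * p < 1 ->
  exists gamma C, 0 < gamma /\ 0 < C /\
  forall (u y : R -> nat -> R) (B : R),
  let v := equilibrium (alpha / beta) d L in
  (forall t k, 0 <= u t k <= 1) ->
  linear_flow alpha beta (fun t k => pow_slope L (u t k) (v k)) y ->
  (forall T e, 0 < e -> exists n0, forall n t, (n0 <= n)%nat -> 0 <= t <= T ->
     p ^ n * Rmax 0 (y t n) <= e) ->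
  (forall n, sum_f_R0 (fun k => p ^ S k * Rmax 0 (y 0 (S k))) n <= B) ->
  forall t n, 0 <= t ->
    sum_f_R0 (fun k => p ^ S k * Rmax 0 (y t (S k))) n
    <= exp (- gamma * t) * (C * B).
Proof.
  intros Hal Hbe Hd Hp Hrp.
  assert (Hr : 0 < alpha / beta) by (apply Rdiv_lt_0_compat; lra).
  set (rho := alpha / beta) in *.
  assert (Ear : alpha = beta * rho) by (unfold rho; field; lra).
  clearbody rho.
  assert (Hrd : rho + d < 1) by nra.
  set (C := p / ((1 - (rho + d)) * (p - 1))).
  assert (HC : 0 < C) by (apply Rdiv_lt_0_compat; nra).
  set (gamma := beta * (1 - (rho + d) * p) * ((1 - (rho + d)) * (p - 1)) / p).
  assert (Hg : 0 < gamma).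
  { apply Rdiv_lt_0_compat; [ | lra ].
    repeat apply Rmult_lt_0_compat; lra. }
  exists gamma, C. split; [ exact Hg | split; [ exact HC | ] ].
  intros u y B v Hu Hflow Hbd HB t n Ht.
  set (om := l1_weight p v).
  assert (Hv : forall k, 0 <= v k <= 1)
    by (intros; apply equilibrium_bounds; lra).
  assert (HvS : forall k, 0 <= v (S k) <= rho + d).
  { intros k. assert (H := equilibrium_S_bounds rho d L k ltac:(lra) Hd
      ltac:(lra)). unfold v; lra. }
  assert (Hlow := fun k => l1_weight_lower p v k ltac:(lra)
    (fun j => conj (proj1 (HvS j)) (Rle_lt_trans _ _ _ (proj2 (HvS j)) Hrd))).
  assert (Hupp := fun k => l1_weight_upper p (rho + d) v k Hp Hrd
    (fun j => proj2 (HvS j))). fold C om in Hupp. fold om in Hlow.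
  assert (Hcmp : forall t n,
    sum_f_R0 (fun k => p ^ S k * Rmax 0 (y t (S k))) n
    <= sum_f_R0 (fun k => om (S k) * Rmax 0 (y t (S k))) n
    <= C * sum_f_R0 (fun k => p ^ S k * Rmax 0 (y t (S k))) n).
  { intros s m; split.
    - apply sum_Rle; intros k _. apply Rmult_le_compat_r; [ apply Rmax_l | ].
      apply Hlow.
    - rewrite scal_sum. apply sum_Rle; intros k _.
      rewrite (Rmult_comm _ C), <- Rmult_assoc.
      apply Rmult_le_compat_r; [ apply Rmax_l | ]. apply Hupp. }
  eapply Rle_trans; [ apply (Hcmp t n) | ].
  apply (positive_part_decay alpha beta gamma (INR L) (C * B) om
    (fun t k => pow_slope L (u t k) (v k)) y); auto.
  - intros k; apply Hlow.
  - intros s k; apply pow_slope_bounds; auto.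
  - intros s k. rewrite Ear at 1.
    apply equilibrium_weight_dissipation; try lra.
    + apply pow_slope_bounds; [ apply Hu | apply Hv ].
    + apply pow_slope_chord; [ apply Hu | apply Hv ].
  - intros T e He.
    destruct (Hbd T (e / C) ltac:(apply Rdiv_lt_0_compat; lra)) as [n0 Hn0].
    exists n0. intros m s Hm Hs.
    specialize (Hn0 (S (S m)) s ltac:(lia) Hs).
    assert (Hm0 := Rmax_l 0 (y s (S (S m)))).
    set (Y := Rmax 0 (y s (S (S m)))) in *.
    assert (Hpm : 0 < p ^ S m) by (apply pow_lt; lra).
    change (p ^ S (S m)) with (p * p ^ S m) in Hn0.
    assert (HPY : 0 <= p ^ S m * Y) by nra.
    assert (H1 : p ^ S m * Y <= e / C) by nra.
    apply Rle_trans with (C * (p ^ S m * Y)).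
    + rewrite <- Rmult_assoc.
      apply Rmult_le_compat_r; [ exact Hm0 | apply Hupp ].
    + apply Rle_trans with (C * (e / C)); [ | right; field; lra ].
      apply Rmult_le_compat_l; lra.
  - intros m. eapply Rle_trans; [ apply (Hcmp 0 m) | ].
    apply Rmult_le_compat_l; [ lra | apply HB ].
Qed.

Lemma abs_term_le_of_sum_sq_le (f : nat -> R) (n : nat) (N : R) :
  0 <= N -> sum_f_R0 (fun k => f k ^ 2) n <= N ^ 2 -> Rabs (f n) <= N.
Proof.
  intros HN H. apply sq_le_abs; [ exact HN | ].
  eapply Rle_trans; [ | exact H ].
  apply (partial_sum_term (fun k => f k ^ 2) n n); [ | lia ].
  intros; apply pow2_ge_0.
Qed.

(** Initially this functional is at most a constant times the l2 norm [N], with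
    the same [p]: a site [m] where [u] exceeds the raised profile has
    [p ^ m * d <= N], and the terms up to the last such site are bounded by a
    geometric sum of order [p ^ m].  The functional is thus linear in [N] for
    large data too, which the plain weighted l1 norm of the difference is
    not. *)
Lemma excess_decay (alpha beta d p : R) (L : nat) :
  0 < alpha -> 0 < beta -> 0 < d -> 1 < p -> (alpha / beta + d) * p < 1 ->
  exists gamma C, 0 < gamma /\ 0 < C /\
  forall (u : R -> nat -> R) (N : R),
  solution_path alpha beta L u -> 0 <= N ->
  (forall T, exists M, forall t k, 0 <= t <= T -> (p ^ k * u t k) ^ 2 <= M) ->
  (forall n, sum_f_R0 (fun k => (p ^ S k *
     (u 0 (S k) - equilibrium (alpha / beta) 0 L (S k))) ^ 2) n <= N ^ 2) ->
  forall t n, 0 <= t ->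
    sum_f_R0 (fun k => p ^ S k *
      Rmax 0 (u t (S k) - equilibrium (alpha / beta) d L (S k))) n
    <= exp (- gamma * t) * (C * N).
Proof.
  intros Hal Hbe Hd Hp Hrp.
  assert (Hr : 0 < alpha / beta) by (apply Rdiv_lt_0_compat; lra).
  assert (Hrd : alpha / beta + d <= 1) by nra.
  destruct (equilibrium_l1_decay alpha beta d p L Hal Hbe ltac:(lra) Hp Hrp)
    as [gamma [C [Hg [HC Hdec]]]].
  exists gamma, (C * (p / (p - 1) / d)).
  assert (Hpp : 0 < p / (p - 1)) by (apply Rdiv_lt_0_compat; lra).
  assert (Hppd : 0 < p / (p - 1) / d) by (apply Rdiv_lt_0_compat; lra).
  split; [ exact Hg | split; [ apply Rmult_lt_0_compat; lra | ] ].
  intros u N Hsol HN HM H0 t n Ht.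
  assert (Hu : forall t k, 0 <= u t k <= 1)
    by (intros; apply in_V_bounds, Hsol).
  rewrite (Rmult_assoc C).
  set (v := equilibrium (alpha / beta) d L).
  assert (HvS : forall k, equilibrium (alpha / beta) 0 L (S k) + d <= v (S k)).
  { intros k. apply equilibrium_shift; lra. }
  assert (HvS' : forall k, d <= v (S k)).
  { intros k. apply equilibrium_S_bounds; lra. }
  apply (Hdec u (fun t k => u t k - v k)); auto.
  - apply difference_flow; assumption.
  - intros T e He. destruct (HM T) as [M HMT].
    assert (Hip : 0 <= / p < 1).
    { split; [ left; apply Rinv_0_lt_compat; lra | ].
      rewrite <- Rinv_1. apply Rinv_lt_contravar; lra. }
    assert (HM0 : 0 < Rabs M + 1) by (assert (H := Rabs_pos M); lra).
    destruct (geometric_eventually_small (/ p) (d / (Rabs M + 1)) Hip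
      ltac:(apply Rdiv_lt_0_compat; lra)) as [n0 Hn0].
    (* u s m is at most a multiple of p ^ (- m), so it is below d <= v m for
       large m, uniformly in s. *)
    exists (S n0). intros m s Hm Hs. destruct m as [|m]; [ lia | ].
    rewrite Rmax_left; [ lra | ].
    specialize (Hn0 (S m) ltac:(lia)). specialize (HMT s (S m) Hs).
    specialize (HvS' m).
    assert (Hb : Rabs (p ^ S m * u s (S m)) <= Rabs M + 1).
    { apply sq_le_abs; [ lra | ]. assert (Hx := Rle_abs M). nra. }
    assert (Hb' := Rle_abs (p ^ S m * u s (S m))).
    assert (Hpm : 0 < p ^ S m) by (apply pow_lt; lra).
    rewrite pow_inv in Hn0.
    enough (u s (S m) <= d) by lra.
    replace (u s (S m)) with (/ p ^ S m * (p ^ S m * u s (S m)))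
      by (field; lra).
    apply Rle_trans with (d / (Rabs M + 1) * (Rabs M + 1)).
    + apply Rle_trans with (/ p ^ S m * (Rabs M + 1)).
      * apply Rmult_le_compat_l; [ left; apply Rinv_0_lt_compat, Hpm | lra ].
      * apply Rmult_le_compat_r; lra.
    + right; field; lra.
  - assert (Hlast : forall m, 0 < u 0 (S m) - v (S m) ->
      sum_f_R0 (fun k => p ^ S k * Rmax 0 (u 0 (S k) - v (S k))) m
      <= p / (p - 1) / d * N).
    { intros m Hm.
      assert (Hpm : 0 < p ^ S m) by (apply pow_lt; lra).
      apply Rle_trans with (p / (p - 1) * p ^ S m).
      - eapply Rle_trans; [ | apply (geometric_sum_le p m Hp) ].
        apply sum_Rle; intros k _.
        assert (Hpk : 0 < p ^ S k) by (apply pow_lt; lra).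
        assert (HR : Rmax 0 (u 0 (S k) - v (S k)) <= 1).
        { apply Rmax_lub; [ lra | ]. specialize (Hu 0 (S k)).
          specialize (HvS' k). lra. }
        nra.
      - replace (p / (p - 1) / d * N) with (p / (p - 1) * (N / d))
          by (field; lra).
        apply Rmult_le_compat_l; [ lra | ].
        apply (Rle_div_r (p ^ S m) N d); [ lra | ].
        assert (H1 := abs_term_le_of_sum_sq_le (fun k => p ^ S k *
          (u 0 (S k) - equilibrium (alpha / beta) 0 L (S k))) m N HN (H0 m)).
        cbv beta in H1.
        assert (H2 := Rle_abs (p ^ S m *
          (u 0 (S m) - equilibrium (alpha / beta) 0 L (S m)))).
        specialize (HvS m). nra. }
    intros m. induction m as [|m IH].
    + destruct (Rle_or_lt (u 0 1%nat - v 1%nat) 0) as [Hm | Hm];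
        [ | apply Hlast, Hm ].
      simpl sum_f_R0. rewrite Rmax_left by exact Hm. rewrite Rmult_0_r. nra.
    + destruct (Rle_or_lt (u 0 (S (S m)) - v (S (S m))) 0) as [Hm | Hm];
        [ | apply Hlast, Hm ].
      rewrite tech5, (Rmax_left 0 _ Hm). lra.
Qed.

(** The weighted l1 norm with a ratio [q < p] is dominated by the l2 norm with
    ratio [p], and it decays.  Only the unweighted sum is kept, as it serves
    for finitely many sites. *)
Lemma difference_l1_decay (alpha beta p : R) (L : nat) :
  0 < alpha -> 0 < beta -> 1 < p -> alpha / beta * p < 1 ->
  exists gamma C, 0 < gamma /\ 0 < C /\
  forall (u : R -> nat -> R) (N : R),
  let x := fun t k => u t k - equilibrium (alpha / beta) 0 L k in
  solution_path alpha beta L u -> 0 <= N ->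
  (forall T, exists M, forall t k, 0 <= t <= T -> (p ^ k * x t k) ^ 2 <= M) ->
  (forall n, sum_f_R0 (fun k => (p ^ S k * x 0 (S k)) ^ 2) n <= N ^ 2) ->
  forall t n, 0 <= t ->
    sum_f_R0 (fun k => Rabs (x t (S k))) n <= exp (- gamma * t) * (C * N).
Proof.
  intros Hal Hbe Hp Hrp.
  assert (Hr : 0 < alpha / beta) by (apply Rdiv_lt_0_compat; lra).
  set (q := (1 + p) / 2).
  assert (Hq : 1 < q < p) by (unfold q; lra).
  destruct (equilibrium_l1_decay alpha beta 0 q L Hal Hbe ltac:(lra)
    ltac:(lra) ltac:(nra)) as [gamma [C [Hg [HC Hdec]]]].
  set (r := q / p).
  assert (Hr1 : 0 < r < 1).
  { unfold r; split; [ apply Rdiv_lt_0_compat; lra | ].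
    apply (Rlt_div_l q 1 p); lra. }
  assert (Erk : forall k, q ^ k = r ^ k * p ^ k).
  { intros k. rewrite <- Rpow_mult_distr. f_equal. unfold r; field; lra. }
  assert (HK : 0 < r / (1 - r)) by (apply Rdiv_lt_0_compat; lra).
  exists gamma, (2 * (C * (r / (1 - r)))).
  split; [ exact Hg | split; [ nra | ] ].
  intros u N x Hsol HN HM H0 t n Ht.
  assert (Hu : forall t k, 0 <= u t k <= 1)
    by (intros; apply in_V_bounds, Hsol).
  assert (Hflow := difference_flow alpha beta 0 L u Hbe Hsol).
  cbv zeta in Hflow. fold x in Hflow.
  assert (Hpk : forall k, 0 < p ^ k) by (intros; apply pow_lt; lra).
  assert (Hrk : forall k, 0 < r ^ k) by (intros; apply pow_lt; lra).
  assert (Hgen : forall y : R -> nat -> R,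
    (forall t k, Rmax 0 (y t k) <= Rabs (x t k)) ->
    linear_flow alpha beta (fun t k =>
      pow_slope L (u t k) (equilibrium (alpha / beta) 0 L k)) y ->
    sum_f_R0 (fun k => q ^ S k * Rmax 0 (y t (S k))) n
    <= exp (- gamma * t) * (C * (r / (1 - r) * N))).
  { intros y Hyx Hy. apply (Hdec u y); auto.
    - intros T e He. destruct (HM T) as [M HMT].
      assert (HM0 : 0 < Rabs M + 1) by (assert (H := Rabs_pos M); lra).
      destruct (geometric_eventually_small r (e / (Rabs M + 1)) ltac:(lra)
        ltac:(apply Rdiv_lt_0_compat; lra)) as [n0 Hn0].
      exists n0. intros m s Hm Hs.
      specialize (Hn0 m Hm). specialize (HMT s m Hs).
      assert (Hb : Rabs (p ^ m * x s m) <= Rabs M + 1).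
      { apply sq_le_abs; [ lra | ]. assert (Hx := Rle_abs M). nra. }
      rewrite Rabs_mult, (Rabs_pos_eq (p ^ m)) in Hb
        by (left; apply Hpk).
      specialize (Hyx s m). specialize (Hpk m). specialize (Hrk m).
      rewrite Erk, Rmult_assoc.
      apply Rle_trans with (e / (Rabs M + 1) * (Rabs M + 1));
        [ | right; field; lra ].
      apply Rmult_le_compat; [ lra | | exact Hn0 | ].
      + apply Rmult_le_pos; [ lra | apply Rmax_l ].
      + eapply Rle_trans; [ | exact Hb ]. apply Rmult_le_compat_l; lra.
    - intros m.
      apply Rle_trans with (sum_f_R0 (fun k => r ^ S k * N) m).
      + apply sum_Rle; intros k _. rewrite Erk, Rmult_assoc.
        apply Rmult_le_compat_l; [ left; apply Hrk | ].
        assert (H1 := abs_term_le_of_sum_sq_le (fun k => p ^ S k * x 0 (S k))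
          k N HN (H0 k)). cbv beta in H1.
        rewrite Rabs_mult, (Rabs_pos_eq (p ^ S k)) in H1
          by (left; apply Hpk).
        eapply Rle_trans; [ | exact H1 ].
        apply Rmult_le_compat_l; [ left; apply Hpk | apply Hyx ].
      + rewrite <- scal_sum, Rmult_comm.
        apply Rmult_le_compat_r; [ exact HN | ].
        apply geometric_sum_bounded; lra. }
  assert (Hplus := Hgen x ltac:(intros; apply Rmax_lub;
    [ apply Rabs_pos | apply Rle_abs ]) Hflow).
  assert (Hminus := Hgen (fun t k => - x t k) ltac:(intros; apply Rmax_lub;
    [ apply Rabs_pos | rewrite <- Rabs_Ropp; apply Rle_abs ])
    (linear_flow_opp _ _ _ _ Hflow)).
  apply Rle_trans with
    (sum_f_R0 (fun k => q ^ S k * Rmax 0 (x t (S k))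
                        + q ^ S k * Rmax 0 (- x t (S k))) n).
  - apply sum_Rle; intros k _.
    assert (Hq1 : 1 <= q ^ S k) by (apply pow_R1_Rle; lra).
    assert (E : Rabs (x t (S k)) = Rmax 0 (x t (S k)) + Rmax 0 (- x t (S k))).
    { unfold Rabs, Rmax. destruct (Rcase_abs (x t (S k))),
        (Rle_dec 0 (x t (S k))), (Rle_dec 0 (- x t (S k))); lra. }
    assert (Hab := Rabs_pos (x t (S k))). rewrite E in Hab |- *. nra.
  - rewrite sum_plus. cbv beta in Hminus. lra.
Qed.

(** * Decay of the weighted l2 norm *)

(** An a priori bound with ratio [p] makes the terms with ratio [P < p] vanish
    at infinity, so boundary terms are discarded for [P] first; estimates that
    are uniform in [P] then pass to [p]. *)
Lemma weighted_sum_left_limit (x : nat -> R) (n : nat) (p q B : R) :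
  0 < q < p ->
  (forall P, q <= P < p ->
     sum_f_R0 (fun k => (P ^ S k * x (S k)) ^ 2) n <= B) ->
  sum_f_R0 (fun k => (p ^ S k * x (S k)) ^ 2) n <= B.
Proof.
  intros Hq H. apply le_epsilon. intros e He.
  assert (Hc : continuity_pt
    (fun P => sum_f_R0 (fun k => (P ^ S k * x (S k)) ^ 2) n) p).
  { apply (evolves_sum (fun k P => (P ^ S k * x (S k)) ^ 2)
      (fun k P => 2 * (P ^ S k * x (S k))
                  * (INR (S k) * P ^ k * x (S k)))); [ | lra ].
    intros k. apply evolves_C1. intros P.
    auto_derive; [ easy | ]. change (Init.Nat.pred (S k)) with k.
    simpl. ring. }
  apply continuity_pt_locally with (eps := mkposreal e He) in Hc.
  destruct Hc as [d Hd]. assert (Hd0 := cond_pos d).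
  set (h := Rmin (d / 2) (p - q)).
  assert (Hh : 0 < h) by (apply Rmin_pos; lra).
  assert (Hh1 : h <= d / 2) by apply Rmin_l.
  assert (Hh2 : h <= p - q) by apply Rmin_r.
  assert (Hball : ball p d (p - h)).
  { change (Rabs (p - h - p) < d). rewrite Rabs_left; lra. }
  specialize (Hd _ Hball). simpl in Hd.
  specialize (H (p - h) ltac:(lra)).
  apply Rabs_lt_between in Hd. simpl in H |- *. lra.
Qed.

Lemma exp_sq (x : R) : exp x ^ 2 = exp (2 * x).
Proof.
  replace (2 * x) with (x + x) by ring. rewrite exp_plus. ring.
Qed.

Lemma decay_square (S g1 g t C N : R) :
  0 <= S -> 0 <= t -> g <= 2 * g1 -> S <= exp (- g1 * t) * (C * N) ->
  S ^ 2 <= C ^ 2 * N ^ 2 * exp (- g * t).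
Proof.
  intros HS Ht Hg H.
  apply Rle_trans with ((exp (- g1 * t) * (C * N)) ^ 2).
  - apply pow_incr; lra.
  - rewrite Rpow_mult_distr, exp_sq, Rpow_mult_distr, Rmult_comm.
    apply Rmult_le_compat_l; [ | apply exp_le_exp; nra ].
    apply Rmult_le_pos; apply pow2_ge_0.
Qed.

(** The energy with weight [P ^ (2 k)], [P < p], is dissipated up to a source
    bounded by the squares of the functionals of [excess_decay] and
    [difference_l1_decay].  Each of these squares decays exponentially from at
    most a constant times [N ^ 2], whence a bound of the same form for the
    energy. *)
Lemma l2_decay (alpha beta p : R) (L : nat) :
  0 < alpha -> 0 < beta -> 1 < p -> alpha / beta * p < 1 -> (1 <= L)%nat ->
  exists gamma C, 0 < gamma /\ 0 < C /\
  forall (u : R -> nat -> R) (N N0 : R),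
  let x := fun t k => u t k - equilibrium (alpha / beta) 0 L k in
  solution_path alpha beta L u -> 0 <= N ->
  (forall n, sum_f_R0 (fun k => (p ^ S k * u 0 (S k)) ^ 2) n <= N0) ->
  (forall n, sum_f_R0 (fun k => (p ^ S k * x 0 (S k)) ^ 2) n <= N ^ 2) ->
  forall t n, 0 <= t ->
    sum_f_R0 (fun k => (p ^ S k * x t (S k)) ^ 2) n
    <= exp (- gamma * t) * (C * N ^ 2).
Proof.
  intros Hal Hbe Hp Hrp HL.
  assert (Hr : 0 < alpha / beta) by (apply Rdiv_lt_0_compat; lra).
  set (q := (1 + p) / 2).
  assert (Hq : 1 < q < p) by (unfold q; lra).
  destruct (edge_estimate alpha beta p q L Hal Hbe Hq Hrp HL)
    as [c [d [kappa [Hc [Hd [Hdp [Hkap Hedge]]]]]]].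
  destruct (excess_decay alpha beta d p L Hal Hbe Hd Hp Hdp)
    as [g1 [C1 [Hg1 [HC1 Hdec1]]]].
  destruct (difference_l1_decay alpha beta p L Hal Hbe Hp Hrp)
    as [g2 [C2 [Hg2 [HC2 Hdec2]]]].
  set (g := Rmin (c / 2) (Rmin (2 * g1) (2 * g2))).
  assert (Hg : 0 < g) by (repeat apply Rmin_pos; lra).
  assert (Hgc : g <= c / 2) by apply Rmin_l.
  assert (Hgg1 : g <= 2 * g1)
    by (eapply Rle_trans; [ apply Rmin_r | apply Rmin_l ]).
  assert (Hgg2 : g <= 2 * g2)
    by (eapply Rle_trans; [ apply Rmin_r | apply Rmin_r ]).
  set (D := kappa * (C1 ^ 2 + C2 ^ 2)).
  assert (HD : 0 <= D) by (apply Rmult_le_pos; nra).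
  assert (HDc : 0 <= 2 * D / c) by (apply Rdiv_le_0_compat; lra).
  exists g, (1 + 2 * D / c).
  split; [ exact Hg | split; [ lra | ] ].
  intros u N N0 x Hsol HN HN0 HxN t n Ht.
  assert (Hu : forall t k, 0 <= u t k <= 1)
    by (intros; apply in_V_bounds, Hsol).
  assert (HMu := weighted_terms_locally_bounded alpha beta p N0 L u Hal Hbe
    ltac:(lra) HL Hsol HN0).
  assert (Hut : forall k, 0 <= p ^ k * equilibrium (alpha / beta) 0 L k <= 1).
  { intros k. assert (Hpk : 0 < p ^ k) by (apply pow_lt; lra).
    assert (H1 := equilibrium_bounds (alpha / beta) 0 L k
      ltac:(lra) ltac:(lra) ltac:(nra)).
    split; [ nra | ].
    assert (H2 := equilibrium_le_geom (alpha / beta) 0 L k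
      ltac:(nra) ltac:(lra) ltac:(nra) HL).
    rewrite Rdiv_0_l, Rplus_0_r in H2.
    apply Rle_trans with (p ^ k * (alpha / beta) ^ k).
    - apply Rmult_le_compat_l; lra.
    - rewrite <- Rpow_mult_distr. apply pow_unit_interval; nra. }
  assert (HMx : forall T, exists M, forall t k, 0 <= t <= T ->
            (p ^ k * x t k) ^ 2 <= M).
  { intros T. destruct (HMu T) as [M HM]. exists (M + 1).
    intros s k Hs. specialize (HM s k Hs). specialize (Hut k).
    assert (Hpu : 0 <= p ^ k * u s k)
      by (apply Rmult_le_pos; [ apply pow_le; lra | apply Hu ]).
    unfold x. rewrite Rmult_minus_distr_l.
    set (X := p ^ k * u s k) in *.
    set (Y := p ^ k * equilibrium (alpha / beta) 0 L k) in *. nra. }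
  assert (HS := fun t n => Hdec1 u N Hsol HN HMu HxN t n).
  assert (HT := fun t n => Hdec2 u N Hsol HN HMx HxN t n).
  apply (weighted_sum_left_limit (x t) n p q); [ lra | ].
  intros P HP.
  destruct (Hedge P ltac:(lra)) as [A [B [HB [HAB Hloc]]]].
  apply (quadratic_energy_decay alpha beta P A B c g (INR L) (D * N ^ 2)
    ((1 + 2 * D / c) * N ^ 2)
    (fun t k => pow_slope L (u t k) (equilibrium (alpha / beta) 0 L k)) x
    (fun t k => kappa * ((p ^ S k *
        Rmax 0 (u t (S k) - equilibrium (alpha / beta) d L (S k))) ^ 2
      + x t (S k) ^ 2))); try lra.
  - apply (difference_flow alpha beta 0 L u Hbe Hsol).
  - intros s k. apply pow_slope_bounds; [ apply Hu | ].
    apply equilibrium_bounds; nra.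
  - intros s k _. apply (Hloc (u s) (Hu s) k).
  - intros s m Hs.
    apply Rle_trans with (kappa * (C1 ^ 2 * N ^ 2 * exp (- g * s)
                                   + C2 ^ 2 * N ^ 2 * exp (- g * s))).
    2:{ right. unfold D. ring. }
    assert (Hsplit : forall f : nat -> R,
      sum_f_R0 (fun k => kappa * f k) m = kappa * sum_f_R0 f m)
      by (intros f; rewrite scal_sum; apply sum_eq; intros; ring).
    rewrite Hsplit, sum_plus.
    apply Rmult_le_compat_l; [ exact Hkap | ].
    apply Rplus_le_compat.
    + eapply Rle_trans; [ apply sum_sq_le_sq_sum | ].
      { intros k; apply Rmult_le_pos; [ apply pow_le; lra | apply Rmax_l ]. }
      apply (decay_square _ g1); try lra; [ | apply HS, Hs ].
      apply cond_pos_sum; intros k.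
      apply Rmult_le_pos; [ apply pow_le; lra | apply Rmax_l ].
    + apply Rle_trans with (sum_f_R0 (fun k => Rabs (x s (S k)) ^ 2) m).
      { right. apply sum_eq; intros k _. apply eq_sym, pow2_abs. }
      eapply Rle_trans; [ apply sum_sq_le_sq_sum; intros; apply Rabs_pos | ].
      apply (decay_square _ g2); try lra; [ | apply HT, Hs ].
      apply cond_pos_sum; intros k; apply Rabs_pos.
  - intros T e He. destruct (HMx T) as [M HM].
    assert (HM0 : 0 < Rabs M + 1) by (assert (H := Rabs_pos M); lra).
    set (r := P / p).
    assert (Hr1 : 0 <= r < 1).
    { unfold r; split; [ apply Rdiv_le_0_compat; lra | ].
      apply (Rlt_div_l P 1 p); lra. }
    destruct (geometric_eventually_small r (e / (Rabs M + 1)) Hr1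
      ltac:(apply Rdiv_lt_0_compat; lra)) as [n0 Hn0].
    exists n0. intros m s Hm Hs.
    specialize (Hn0 m Hm). specialize (HM s m Hs).
    replace (P ^ m * x s m) with (r ^ m * (p ^ m * x s m)).
    2:{ rewrite <- Rmult_assoc, <- Rpow_mult_distr.
        replace (r * p) with P by (unfold r; field; lra). reflexivity. }
    rewrite Rpow_mult_distr.
    assert (Hrm := pow_unit_interval r m ltac:(lra)).
    assert (Hx := Rle_abs M). assert (Hx2 := pow2_ge_0 (p ^ m * x s m)).
    apply Rle_trans with (e / (Rabs M + 1) * (Rabs M + 1));
      [ | right; field; lra ].
    apply Rmult_le_compat; [ apply pow2_ge_0 | exact Hx2 | nra | lra ].
  - assert (HN2 := pow2_ge_0 N).
    assert (H1 : D * N ^ 2 <= (1 + 2 * D / c) * N ^ 2 * (c / 2)).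
    { replace ((1 + 2 * D / c) * N ^ 2 * (c / 2))
        with (c / 2 * N ^ 2 + D * N ^ 2) by (field; lra). nra. }
    eapply Rle_trans; [ exact H1 | ].
    apply Rmult_le_compat_l; [ | lra ]. apply Rmult_le_pos; lra.
  - intros m. apply Rle_trans with (N ^ 2).
    + eapply Rle_trans; [ | apply (HxN m) ].
      apply sum_Rle; intros k _. rewrite !Rpow_mult_distr.
      apply Rmult_le_compat_r; [ apply pow2_ge_0 | ].
      apply pow_incr; split; [ apply pow_le; lra | ].
      apply pow_incr; lra.
    + assert (HN2 := pow2_ge_0 N). nra.
Qed.

(** * From partial sums to the norm *)

Lemma nonneg_series_le (a : nat -> R) (B : R) :
  (forall n, 0 <= a n) -> (forall n, sum_f_R0 a n <= B) ->
  ex_series a /\ Series a <= B.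
Proof.
  intros Ha HB.
  assert (Hex : ex_finite_lim_seq (sum_n a)).
  { apply ex_finite_lim_seq_incr with B.
    - intros n. rewrite sum_Sn. specialize (Ha (S n)).
      change (sum_n a n <= sum_n a n + a (S n)). lra.
    - intros n. rewrite sum_n_Reals. apply HB. }
  destruct Hex as [l Hl].
  assert (Hs : is_series a l) by exact Hl.
  split; [ exists l; exact Hs | ].
  rewrite (is_series_unique a l Hs).
  apply (is_lim_seq_le (sum_n a) (fun _ => B) l B); [ | exact Hl | ].
  - intros n; rewrite sum_n_Reals; apply HB.
  - apply is_lim_seq_const.
Qed.

Lemma partial_sum_le_Series (a : nat -> R) (n : nat) :
  (forall n, 0 <= a n) -> ex_series a -> sum_f_R0 a n <= Series a.
Proof.
  intros Ha Hex. apply sum_incr; [ | exact Ha ].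
  apply is_series_Reals, Series_correct, Hex.
Qed.

Lemma L2_term_geom (theta p : R) (x : nat -> R) (k : nat) :
  0 < theta -> 0 < p -> p ^ 2 = / theta ->
  L2_term (geom_weight theta) x k = (p ^ S k * x (S k)) ^ 2.
Proof.
  intros Ht Hp E. unfold L2_term, geom_weight.
  rewrite <- pow_inv, <- E, Rpow_mult_distr, <- !pow_mult, Nat.mul_comm.
  apply Rmult_comm.
Qed.

Theorem theorem2p8 (alpha beta : R) (L : nat) (theta : R)
    (Halpha : 0 < alpha) (Hbeta : 0 < beta) (Hrho : alpha / beta < 1)
    (HL : (1 <= L)%nat)
    (Htheta : alpha / beta <= theta < 1) :
  exists gamma C : R,
    0 < gamma /\
    forall u0 : nat -> R,
      in_V u0 -> L2_summable (geom_weight theta) u0 ->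
      forall u : R -> nat -> R,
        is_solution_in_V alpha beta L u ->
        (forall k, u 0 k = u0 k) ->
        forall t : R, 0 <= t ->
          in_L2 (geom_weight theta)
            (fun k => u t k - u_tilde (alpha / beta) L k) /\
          L2_norm (geom_weight theta)
            (fun k => u t k - u_tilde (alpha / beta) L k)
          <= exp (- gamma * t) * C *
             L2_norm (geom_weight theta)
               (fun k => u0 k - u_tilde (alpha / beta) L k).
Proof.
  assert (Hr : 0 < alpha / beta) by (apply Rdiv_lt_0_compat; lra).
  assert (Ht0 : 0 < theta) by lra.
  set (p := / sqrt theta).
  assert (Hst : 0 < sqrt theta) by (apply sqrt_lt_R0; lra).
  assert (Hst2 : sqrt theta * sqrt theta = theta) by (apply sqrt_sqrt; lra).
  assert (Hst1 : sqrt theta < 1) by nra.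
  assert (Hp : 1 < p).
  { unfold p. rewrite <- Rinv_1. apply Rinv_lt_contravar; lra. }
  assert (Hp2 : p ^ 2 = / theta).
  { unfold p. rewrite <- Hst2 at 2. field. lra. }
  assert (Hrp : alpha / beta * p < 1).
  { apply Rle_lt_trans with (theta * p).
    - apply Rmult_le_compat_r; lra.
    - replace (theta * p) with (sqrt theta); [ exact Hst1 | ].
      unfold p. rewrite <- Hst2 at 2. field. lra. }
  destruct (l2_decay alpha beta p L Halpha Hbeta Hp Hrp HL)
    as [gamma [C [Hgamma [HC Hdec]]]].
  exists (gamma / 2), (sqrt C). split; [ lra | ].
  intros u0 Hu0 Hsum u Hu Hinit t Ht.
  set (w := geom_weight theta).
  set (x := fun t k => u t k - u_tilde (alpha / beta) L k).
  set (x0 := fun k => u0 k - u_tilde (alpha / beta) L k).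
  change (in_L2 w (x t) /\ L2_norm w (x t)
          <= exp (- (gamma / 2) * t) * sqrt C * L2_norm w x0).
  assert (Hterm : forall y k, L2_term w y k = (p ^ S k * y (S k)) ^ 2)
    by (intros; apply L2_term_geom; lra).
  assert (Hpos : forall y k, 0 <= L2_term w y k)
    by (intros; rewrite Hterm; apply pow2_ge_0).
  assert (Hpart : forall y n, sum_f_R0 (L2_term w y) n
                  = sum_f_R0 (fun k => (p ^ S k * y (S k)) ^ 2) n)
    by (intros; apply sum_eq; intros; apply Hterm).
  assert (HN0 := fun n => partial_sum_le_Series _ n (Hpos u0) Hsum).
  assert (Hx0sum : L2_summable w x0).
  { apply (nonneg_series_le _ (Series (L2_term w u0)
      + alpha / beta * p / (1 - alpha / beta * p)) (Hpos x0)).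
    intros n.
    eapply Rle_trans; [ | apply Rplus_le_compat;
      [ apply (HN0 n) | apply (geometric_sum_bounded _ n); nra ] ].
    rewrite <- sum_plus. apply sum_Rle; intros k _. rewrite !Hterm.
    assert (Hpk : 0 < p ^ S k) by (apply pow_lt; lra).
    assert (H1 := equilibrium_bounds (alpha / beta) 0 L (S k)
      ltac:(lra) ltac:(lra) ltac:(lra)).
    assert (H2 := equilibrium_le_geom (alpha / beta) 0 L (S k)
      ltac:(lra) ltac:(lra) ltac:(lra) HL).
    rewrite Rdiv_0_l, Rplus_0_r in H2.
    assert (H3 := in_V_bounds u0 (S k) Hu0).
    assert (H4 := pow_unit_interval (alpha / beta * p) (S k) ltac:(nra)).
    unfold x0. rewrite u_tilde_equilibrium, Rmult_minus_distr_l.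
    assert (H5 : 0 <= p ^ S k * u0 (S k)) by (apply Rmult_le_pos; lra).
    assert (H6 : 0 <= p ^ S k * equilibrium (alpha / beta) 0 L (S k))
      by (apply Rmult_le_pos; lra).
    assert (H7 : p ^ S k * equilibrium (alpha / beta) 0 L (S k)
                 <= (alpha / beta * p) ^ S k).
    { rewrite Rpow_mult_distr, Rmult_comm.
      apply Rmult_le_compat_r; lra. }
    set (X := p ^ S k * u0 (S k)) in *.
    set (Y := p ^ S k * equilibrium (alpha / beta) 0 L (S k)) in *.
    set (Z := (alpha / beta * p) ^ S k) in *. nra. }
  set (N := L2_norm w x0).
  assert (HN : 0 <= N) by apply sqrt_pos.
  assert (HN2 : N ^ 2 = Series (L2_term w x0)).
  { unfold N, L2_norm. apply pow2_sqrt.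
    eapply Rle_trans; [ | apply (partial_sum_le_Series _ 0 (Hpos x0) Hx0sum) ].
    apply Hpos. }
  assert (Hsol := solution_path_extension alpha beta L u Hu).
  assert (Hbound : forall n, sum_f_R0 (L2_term w (x t)) n
                   <= exp (- gamma * t) * (C * N ^ 2)).
  { intros n. rewrite Hpart.
    assert (H := Hdec _ N (Series (L2_term w u0)) Hsol HN). cbv beta zeta in H.
    rewrite (Rmax_left 0 0) in H by lra.
    assert (H' := fun A B => H A B t n Ht).
    rewrite (Rmax_right 0 t) in H' by lra.
    eapply Rle_trans; [ right | apply H' ].
    - apply sum_eq; intros k _. unfold x.
      rewrite u_tilde_equilibrium. reflexivity.
    - intros m. eapply Rle_trans; [ right | apply (HN0 m) ].
      rewrite Hpart. apply sum_eq; intros k _. rewrite Hinit. reflexivity.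
    - intros m. rewrite HN2.
      eapply Rle_trans; [ right |
        apply (partial_sum_le_Series _ m (Hpos x0) Hx0sum) ].
      rewrite Hpart. apply sum_eq; intros k _. unfold x0.
      rewrite Hinit, u_tilde_equilibrium. reflexivity. }
  destruct (nonneg_series_le _ _ (Hpos (x t)) Hbound) as [Hs1 Hs2].
  split; [ split | ].
  - unfold x. destruct Hu as [HV _]. destruct (HV t Ht) as [-> _].
    rewrite u_tilde_equilibrium. simpl. ring.
  - exact Hs1.
  - unfold L2_norm at 1.
    eapply Rle_trans; [ apply sqrt_le_1_alt, Hs2 | ].
    right. apply sqrt_lem_1.
    + apply Rmult_le_pos; [ left; apply exp_pos | ].
      apply Rmult_le_pos; [ lra | apply pow2_ge_0 ].
    + apply Rmult_le_pos; [ | exact HN ].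
      apply Rmult_le_pos; [ left; apply exp_pos | apply sqrt_pos ].
    + replace (exp (- gamma * t)) with (exp (- (gamma / 2) * t) ^ 2)
        by (rewrite exp_sq; f_equal; field).
      assert (Hsc := sqrt_sqrt C ltac:(lra)).
      rewrite <- Hsc at 3. ring.
Qed.
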